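(* Let $\mathcal{H}=\mathcal{H}(X)$ be a reproducing kernel Hilbert space on a nonempty set $X$, let $M,N\in\mathcal{B}(\mathcal{H})$ have closed ranges, and let $r\geq1$ be real. Then $$\begin{aligned}\mathbf{ber}^{2r}(M+N)\leq{}&2^{2r-3}\left(\mathbf{ber}^2\left(|M|^{2r}+i(NN^\dagger)^r\right)+\mathbf{ber}^2\left(|N|^{2r}+i(MM^\dagger)^r\right)\right)\\&+2^{2r-4}\,\mathbf{ber}^2\left(|M|^{2r}+(NN^\dagger)^r+i\left(|N|^{2r}+(MM^\dagger)^r\right)\right).\end{aligned}$$
   Context: A reproducing kernel Hilbert space $\mathcal{H}(X)$ is a complex Hilbert space of complex-valued functions on $X$ on which every evaluation $\phi\mapsto\phi(x)$, $x\in X$, is continuous; $k_x\in\mathcal{H}$ is the element with $\phi(x)=\langle\phi,k_x\rangle$ for all $\phi\in\mathcal{H}$, and $\hat k_x=k_x/\|k_x\|$ is the normalized reproducing kernel (for $k_x\ne0$). $\mathcal{B}(\mathcal{H})$ is the algebra of bounded linear operators on $\mathcal{H}$. The Berezin number is $\mathbf{ber}(T)=\sup_{x}|\langle T\hat k_x,\hat k_x\rangle|$, over all $x\in X$ for which $\hat k_x$ is defined; $\mathbf{ber}^p(T)$ means $(\mathbf{ber}(T))^p$. $|T|=\sqrt{T^*T}$, and $i$ is the imaginary unit. For a closed-range $T\in\mathcal{B}(\mathcal{H})$, $T^\dagger$ is the Moore–Penrose inverse: the unique bounded operator with $TT^\dagger T=T$, $T^\dagger TT^\dagger=T^\dagger$,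 $(TT^\dagger)^*=TT^\dagger$, $(T^\dagger T)^*=T^\dagger T$. Real powers of positive operators are taken via functional calculus. *)

(* Defs.v *)
From HB Require Import structures.
From mathcomp Require Import all_boot all_order all_algebra.
From mathcomp Require Import sesquilinear.
From mathcomp Require Import complex.
From mathcomp Require Import all_classical all_reals all_analysis.

Set Implicit Arguments.
Unset Strict Implicit.
Unset Printing Implicit Defensive.
Import Order.TTheory GRing.Theory Num.Theory.
Import numFieldNormedType.Exports.
Local Open Scope classical_set_scope.
Local Open Scope complex_scope.
Local Open Scope ring_scope.

(* The elements of the space are functions on X through [rk_eval], which is
   linear and injective; [rk_inner] is linear in its first argument and
   conjugate-linear in its second one. Norms take their values in R[i]. *)
Record rkhs (R : realType) (X : Type) := RKHS {
  rk_space :> completeNormedModType R[i] ;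
  rk_inner : {dot rk_space for @Num.conj R[i]} ;
  rk_norm_inner : forall u : rk_space, `|u| ^+ 2 = rk_inner u u ;
  rk_eval : rk_space -> X -> R[i]^o ;
  rk_eval_linear : linear rk_eval ;
  rk_eval_inj : injective rk_eval ;
  rk_eval_continuous : forall x : X, continuous (fun u => rk_eval u x)
}.

Notation "''[' u , v ]" := (rk_inner _ u v)
  (format "''[' u ,  v ]") : ring_scope.

Section Operators.
Variables (R : realType) (X : Type) (H : rkhs R X).
Implicit Types (A B S T : H -> H) (u v : H) (x : X).

Definition bounded_op T : Prop := linear T /\ continuous T.

(* Zero when T has no adjoint; every bounded operator has one. *)
Definition adjoint T : H -> H :=
  xget 0 [set S | forall u v, '[T u, v] = '[u, S v]].

Definition is_moore_penrose T S : Prop :=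
  [/\ bounded_op S, T \o S \o T = T, S \o T \o S = S,
      adjoint (T \o S) = T \o S & adjoint (S \o T) = S \o T].

Definition moore_penrose T : H -> H := xget 0 [set S | is_moore_penrose T S].

Definition spectrum T : set R[i] :=
  [set l | ~ exists S, [/\ bounded_op S, (T - l *: id) \o S = id
                         & S \o (T - l *: id) = id]].

Definition poly_op (p : {poly R}) A : H -> H :=
  fun u => \sum_(i < size p) (p`_i)%:C *: iter i A u.

(* Continuous functional calculus of a self-adjoint A (whose spectrum is real):
   B is the operator-norm limit of p_n(A), where the p_n are real polynomials
   that converge to f uniformly on the spectrum. *)
Definition is_fun_calc (f : R -> R) A B : Prop :=
  bounded_op B /\ exists p : nat -> {poly R},
    {uniform [set t : R | spectrum A t%:C],
      (fun n t => (p n).[t]) @ \oo --> f} /\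
    {uniform [set u : H | `|u| <= 1],
      (fun n => poly_op (p n) A) @ \oo --> B}.

Definition fun_calc (f : R -> R) A : H -> H := xget 0 [set B | is_fun_calc f A B].

(* Meant for a positive A, whose spectrum lies in [0, +oo[. *)
Definition op_pow A (s : R) : H -> H := fun_calc (fun t => t `^ s) A.

Definition op_abs T : H -> H := fun_calc Num.sqrt (adjoint T \o T).

Definition rkernel x : H := xget 0 [set k | forall u, rk_eval u x = '[u, k]].

Definition nkernel x : H := `|rkernel x|^-1 *: rkernel x.

(* The set is bounded for a bounded T; when it is empty, which happens only for
   the zero space, [sup] gives 0. *)
Definition ber T : R :=
  sup [set complex.Re `|'[T (nkernel x), nkernel x]| | x in
         [set x | rkernel x != 0]].

End Operators.

(* Main.v *)
Require Import Defs.
From HB Require Import structures.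
From mathcomp Require Import all_boot all_order all_algebra.
From mathcomp Require Import sesquilinear.
From mathcomp Require Import complex.
From mathcomp Require Import all_classical all_reals all_analysis.
From mathcomp Require Import ring lra.

Set Implicit Arguments.
Unset Strict Implicit.
Unset Printing Implicit Defensive.
Import Order.TTheory GRing.Theory Num.Theory.
Import numFieldNormedType.Exports.
Local Open Scope classical_set_scope.
Local Open Scope complex_scope.
Local Open Scope ring_scope.

(** Write [P_M = M M^+]; it is the orthogonal projection onto the range of [M], so
    that [P_M M = M] and, for a unit vector [u],
    [|<M u, u>| = |<M u, P_M u>| <= |M u| |P_M u|]; the same holds for [N].  Let
    [A = <|M|^(2r) u, u>], [P = <P_M^r u, u>], [B = <|N|^(2r) u, u>] and
    [Q = <P_N^r u, u>].  McCarthy's inequality [<T u, u>^r <= <T^r u, u>] for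
    [T >= 0] and [r >= 1] gives [|M u|^(2r) <= A], [|P_M u|^(2r) <= P], and so on,
    and convexity of the power with the arithmetic-geometric mean turns the bound
    for [|<(M + N) u, u>|^(2r)] into
    [2^(2r-3) (A^2 + Q^2 + B^2 + P^2) + 2^(2r-4) ((A + Q)^2 + (B + P)^2)]
    ([scalar_bound]).  As [A], [B], [P], [Q] are real, the squares pair up into
    [|<(|M|^(2r) + i P_N^r) u, u>|^2] and its analogues, each at most the square of
    a Berezin number.

    Most of the work is to show that the operators in the statement exist with
    the expected properties.

    - Adjoints come from the Riesz representation ([riesz]), itself obtained from
      orthogonal projections.  The Moore-Penrose inverse of an operator with closed
      range is [M^* S], with [S] the inverse of [M M^* + 1 - P_M]; that operator
      is coercive by the uniform boundedness principle, hence invertible by the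
      Lax-Milgram argument ([moore_penrose_exists]).

    - The functional calculus rests on [poly_op_ge0]: a real polynomial that is
      nonnegative on the spectrum of a symmetric operator [A] takes a nonnegative
      value at [A].  The infimum of the quadratic form of [p(A)] is shown to be a
      value of [p] on the spectrum, by factoring [p - m] over the complex numbers.
      It follows that [p |-> p(A)] is a contraction from the uniform norm on the
      spectrum, so that Bernstein's approximations of the square root and of the
      powers make the calculus converge ([fun_calc_exists]), and that the
      calculus is monotone ([fun_calc_lower]), which yields McCarthy's inequality
      by comparing a power with its tangents ([mccarthy]). *)

(** * Real parts of the norm and of the inner product *)

Section Geometry.
Variables (R : realType) (X : Type) (H : rkhs R X).
Implicit Types (u v w : H) (a : R) (c : R[i]).

Lemma ReD (z w : R[i]) : complex.Re (z + w) = complex.Re z + complex.Re w.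
Proof. by case: z w => ? ? []. Qed.

Lemma ReN (z : R[i]) : complex.Re (- z) = - complex.Re z.
Proof. by case: z. Qed.

Lemma ReZ a (z : R[i]) : complex.Re (a%:C * z) = a * complex.Re z.
Proof. by case: z => x y /=; rewrite mul0r subr0. Qed.

Lemma complex_eta (z : R[i]) : z = complex.Re z +i* complex.Im z.
Proof. by case: z. Qed.

(** Estimates are carried out in the real Hilbert space underlying [H], whose inner
    product is the real part of the complex one: its values are in the ordered
    field [R], while those of the norm of [H] are in [R[i]]. *)
Definition rinner u v : R := complex.Re '[u, v].
Definition rnorm u : R := complex.Re `|u|.

Lemma normE u : `|u| = (rnorm u)%:C.
Proof. by rewrite /rnorm RRe_real// normr_real. Qed.

Lemma Re_norm_ge0 (z : R[i]) : 0 <= complex.Re `|z|.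
Proof. by rewrite -ler0c RRe_real ?normr_real. Qed.

Lemma rnorm_ge0 u : 0 <= rnorm u.
Proof. by rewrite -ler0c -normE. Qed.

Lemma rnorm0 : rnorm 0 = 0.
Proof. by rewrite /rnorm normr0. Qed.

Lemma rnorm_eq0 u : rnorm u = 0 -> u = 0.
Proof. by move=> u0; apply/normr0_eq0; rewrite normE u0. Qed.

Lemma rnorm_gt0 u : (0 < rnorm u) = (u != 0).
Proof. by rewrite -ltcR -normE normr_gt0. Qed.

Lemma rnormD u v : rnorm (u + v) <= rnorm u + rnorm v.
Proof.
by rewrite -lecR rmorphD/= -!normE ler_normD.
Qed.

Lemma rnormZ c u : rnorm (c *: u) = complex.Re `|c| * rnorm u.
Proof.
by apply: complexI; rewrite rmorphM/= -!normE normrZ; congr (_ * _).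
Qed.

Lemma rnormZr a u : rnorm (a%:C *: u) = `|a| * rnorm u.
Proof. by rewrite rnormZ normc_def/= expr0n/= addr0 sqrtr_sqr. Qed.

Lemma rnormN u : rnorm (- u) = rnorm u.
Proof. by rewrite /rnorm normrN. Qed.

Lemma rnormB u v : rnorm (u - v) <= rnorm u + rnorm v.
Proof. by rewrite (le_trans (rnormD _ _))// rnormN. Qed.

Lemma rdistC u v : rnorm (u - v) = rnorm (v - u).
Proof. by rewrite -rnormN opprB. Qed.

Lemma rdistD w u v : rnorm (u - v) <= rnorm (u - w) + rnorm (w - v).
Proof. by rewrite (le_trans _ (rnormD _ _))// addrA subrK. Qed.

Lemma rinnerC u v : rinner u v = rinner v u.
Proof.
have Re_conj (z : R[i]) : complex.Re (Num.conj z) = complex.Re z by case: z.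
by rewrite /rinner hermC expr0 mul1r; exact: Re_conj.
Qed.

Lemma rinnerDl u v w : rinner (u + v) w = rinner u w + rinner v w.
Proof. by rewrite /rinner linearDl; exact: ReD. Qed.

Lemma rinnerNl u w : rinner (- u) w = - rinner u w.
Proof. by rewrite /rinner linearNl; exact: ReN. Qed.

Lemma rinnerZl a u w : rinner (a%:C *: u) w = a * rinner u w.
Proof. by rewrite /rinner linearZl_LR; exact: ReZ. Qed.

Lemma rinner0l w : rinner 0 w = 0.
Proof. by rewrite /rinner linear0l. Qed.

Lemma rinnerBl u v w : rinner (u - v) w = rinner u w - rinner v w.
Proof. by rewrite rinnerDl rinnerNl. Qed.

Lemma rinnerDr u v w : rinner w (u + v) = rinner w u + rinner w v.
Proof. by rewrite !(rinnerC w) rinnerDl. Qed.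

Lemma rinnerNr u w : rinner w (- u) = - rinner w u.
Proof. by rewrite !(rinnerC w) rinnerNl. Qed.

Lemma rinnerZr a u w : rinner w (a%:C *: u) = a * rinner w u.
Proof. by rewrite !(rinnerC w) rinnerZl. Qed.

Lemma rinner0r w : rinner w 0 = 0.
Proof. by rewrite rinnerC rinner0l. Qed.

Lemma rinnerBr u v w : rinner w (u - v) = rinner w u - rinner w v.
Proof. by rewrite rinnerDr rinnerNr. Qed.

Lemma rinnerxx u : rinner u u = rnorm u ^+ 2.
Proof.
rewrite /rinner -rk_norm_inner normE.
by rewrite -rmorphXn.
Qed.

Lemma rnormD_sqr u v :
  rnorm (u + v) ^+ 2 = rnorm u ^+ 2 + 2 * rinner u v + rnorm v ^+ 2.
Proof. by rewrite -!rinnerxx rinnerDl !rinnerDr (rinnerC v u); ring. Qed.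

Lemma rnormB_sqr u v :
  rnorm (u - v) ^+ 2 = rnorm u ^+ 2 - 2 * rinner u v + rnorm v ^+ 2.
Proof. by rewrite rnormD_sqr rinnerNr rnormN; ring. Qed.

Lemma rinner_le u v : rinner u v <= rnorm u * rnorm v.
Proof.
have : rnorm (u + v) ^+ 2 <= (rnorm u + rnorm v) ^+ 2.
  by rewrite ler_sqr ?nnegrE ?addr_ge0 ?rnorm_ge0// rnormD.
by rewrite rnormD_sqr; nra.
Qed.

Lemma normr_rinner_le u v : `|rinner u v| <= rnorm u * rnorm v.
Proof.
rewrite ler_norml rinner_le andbT lerNl -rinnerNl.
by rewrite (le_trans (rinner_le _ _))// rnormN.
Qed.

(** The complex inner product is determined by its real part. *)
Lemma innerE u v : '[u, v] = rinner u v +i* - rinner ('i%C *: u) v.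
Proof.
rewrite /rinner linearZl_LR/= mulrC ReiNIm opprK.
exact: (complex_eta).
Qed.

Lemma norm_inner_le u v : complex.Re `|'[u, v]| <= rnorm u * rnorm v.
Proof.
(* Rotating the first vector makes the inner product real and nonnegative. *)
set z := '[u, v].
have [->|z0] := eqVneq z 0; first by rewrite normr0 mulr_ge0 ?rnorm_ge0.
have zgt0 : 0 < complex.Re `|z|.
  by rewrite -ltcR RRe_real ?normr_real// normr_gt0.
have := rinner_le (z^*%C *: u) v.
rewrite rnormZ normcJ /rinner linearZl_LR/= -/z mulrC -sqr_normc.
have -> : `|z| = (complex.Re `|z|)%:C by rewrite RRe_real// normr_real.
by rewrite -rmorphXn/= expr2 -mulrA ler_pM2l.
Qed.

End Geometry.

Section Linear.
Variables (R : realType) (X : Type) (H : rkhs R X) (T : H -> H).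
Hypothesis lT : linear T.

Lemma lin0 : T 0 = 0.
Proof. by have := lT (-1) 0 0; rewrite scaler0 addr0 scaleN1r addNr. Qed.

Lemma linDE u v : T (u + v) = T u + T v.
Proof. by have := lT 1 u v; rewrite !scale1r. Qed.

Lemma linZE c u : T (c *: u) = c *: T u.
Proof. by have := lT c u 0; rewrite !addr0 lin0 addr0. Qed.

Lemma linNE u : T (- u) = - T u.
Proof. by rewrite -scaleN1r linZE scaleN1r. Qed.

Lemma linBE u v : T (u - v) = T u - T v.
Proof. by rewrite linDE linNE. Qed.

Definition packed_linear : {linear H -> H} :=
  HB.pack T (GRing.isLinear.Build _ _ _ _ _ lT).
End Linear.

(** * Limits, boundedness and uniform convergence in real terms *)

Section Topology.
Variables (R : realType) (X : Type) (H : rkhs R X).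
Implicit Types (u v w : H) (a : R) (c : R[i]).

Definition seq_lim (x : nat -> H) (l : H) :=
  forall e : R, 0 < e -> exists N, forall n, (N <= n)%N -> rnorm (x n - l) < e.

Lemma gt0_complexP (e : R[i]) : 0 < e -> exists2 a, 0 < a & e = a%:C.
Proof.
by case: e => a b; rewrite ltcE/= => /andP[/eqP -> a0]; exists a.
Qed.

Lemma seq_limP (x : nat -> H) l : seq_lim x l <-> x @ \oo --> l.
Proof.
split=> [xl|/cvgrPdist_lt xl e e0].
  apply/cvgrPdist_lt => e /gt0_complexP[a a0 ->].
  have [N xN] := xl a a0; exists N => // n /= Nn.
  by rewrite normE ltcR rdistC xN.
have [|N _ xN] := xl e%:C; first by rewrite ltcR.
by exists N => n /xN /=; rewrite normE ltcR rdistC.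
Qed.

Lemma cauchy_seq_lim (x : nat -> H) :
  (forall e : R, 0 < e -> exists N, forall m n, (N <= m)%N -> (N <= n)%N ->
     rnorm (x m - x n) < e) ->
  exists l, seq_lim x l.
Proof.
move=> xC; suff /cauchy_cvgP/cvg_ex[l xl] : cauchy (x @ \oo).
  by exists l; apply/seq_limP.
apply: cauchy_exP => e /gt0_complexP[a a0 ->].
have [N xN] := xC a a0; exists (x N); exists N => // n /= Nn.
by rewrite -ball_normE /= normE ltcR xN.
Qed.

Lemma closed_seq_lim (V : set H) (x : nat -> H) l :
  closed V -> (forall n, V (x n)) -> seq_lim x l -> V l.
Proof.
by move=> cV xV /seq_limP; apply: closed_cvg => //; exact: nearW.
Qed.

Lemma bounded_opP (T : H -> H) :
  bounded_op T <-> linear T /\ exists2 C, 0 <= C & forall u, rnorm (T u) <= C * rnorm u.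
Proof.
split=> -[lT cT]; split=> //.
  have /linear_boundedP/pinfty_ex_gt0[c /gt0_complexP[a a0 ->] Ta] :
      bounded_near (packed_linear lT) (nbhs 0).
    exact/linear_bounded_continuous.
  exists a => [|u]; first exact: ltW.
  by have := Ta u; rewrite !normE -rmorphM lecR; exact.
have [C C0 TC] := cT.
apply/(@linear_bounded_continuous _ _ _ (packed_linear lT))/linear_boundedP.
near=> c => u.
rewrite (@le_trans _ _ (C%:C * `|u|))//.
  by rewrite !normE -rmorphM lecR; exact: TC.
by rewrite ler_wpM2r//; near: c; apply: nbhs_pinfty_ge; rewrite ger0_real// ler0c.
Unshelve. all: by end_near. Qed.

Lemma uniform_ballP (F : nat -> H -> H) (B : H -> H) :
  {uniform [set u : H | `|u| <= 1], F @ \oo --> B} <->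
  forall e : R, 0 < e -> exists N, forall n, (N <= n)%N -> forall u,
    rnorm u <= 1 -> rnorm (F n u - B u) < e.
Proof.
split=> [FB e e0|FB].
  have /FB[N _ NF] : nbhs (B : {uniform` [set u : H | `|u| <= 1] -> H})
      [set h | forall u, `|u| <= 1 -> rnorm (h u - B u) < e].
    apply/uniform_nbhs; exists [set uv | ball uv.1 e%:C uv.2]; split.
      by rewrite -entourage_ballE; exists e%:C => //=; rewrite ltcR.
    move=> h /= hE u u1; have := hE u u1.
    by rewrite -ball_normE /= normE ltcR rdistC.
  by exists N => n /NF /= h u u1; apply: h; rewrite normE lecR.
move=> P /uniform_nbhs[E [/= +]] EP.
rewrite -entourage_ballE => -[e /gt0_complexP[a a0 ->]] eE.
have [N NF] := FB a a0; exists N => // n /= Nn; apply: EP => u /= u1.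
apply: eE; rewrite -ball_normE /= normE ltcR rdistC NF//.
by rewrite normE lecR in u1.
Qed.

End Topology.

Lemma uniform_realP (R : realType) (A : set R) (F : nat -> R -> R) (f : R -> R) :
  {uniform A, F @ \oo --> f} <->
  forall e : R, 0 < e -> exists N, forall n, (N <= n)%N -> forall t, A t ->
    `|F n t - f t| < e.
Proof.
split=> [FB e e0|FB].
  have /FB[N _ NF] : nbhs (f : {uniform` A -> R})
      [set h | forall t, A t -> `|h t - f t| < e].
    apply/uniform_nbhs; exists [set uv | ball uv.1 e uv.2]; split.
      by rewrite -entourage_ballE; exists e.
    move=> h /= hE u u1; have := hE u u1.
    by rewrite -ball_normE /= distrC.
  by exists N => n /NF /= h u u1; apply: h.
move=> P /uniform_nbhs[E [/= +]] EP.
rewrite -entourage_ballE => -[e e0 eE].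
have [N NF] := FB e e0; exists N => // n /= Nn; apply: EP => u /= u1.
by apply: eE; rewrite -ball_normE /= distrC NF.
Qed.
(** * Projections, adjoints and coercive operators *)

Section Completeness.
Variables (R : realType) (X : Type) (H : rkhs R X).
Implicit Types (u v w z : H) (x : nat -> H) (e q a : R).

Lemma invS_small e : 0 < e -> exists N, forall n, (N <= n)%N -> n.+1%:R^-1 < e.
Proof.
move=> e0; exists (Num.truncn e^-1) => n Nn.
rewrite -ltf_pV2 ?posrE ?invrK ?invr_gt0//.
by rewrite (lt_le_trans (truncnS_gt _))// ler_nat.
Qed.

Lemma geometric_small a q e : 0 <= q < 1 -> 0 < e -> exists n, a * q ^+ n < e.
Proof.
move=> /andP[q0 q1] e0.
have /cvgrPdist_lt/(_ e e0)[N _ qN] : geometric a q @ \oo --> (0 : R).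
  by apply: cvg_geometric; rewrite ger0_norm.
exists N; have := qN N (leqnn N); rewrite /geometric/= sub0r normrN.
exact/le_lt_trans/ler_norm.
Qed.

Lemma geometric_seq_lim x a q :
  0 <= q < 1 -> (forall n, rnorm (x n.+1 - x n) <= a * q ^+ n) ->
  exists2 l, seq_lim x l & forall n, rnorm (l - x n) <= a * q ^+ n / (1 - q).
Proof.
move=> q01 xq; have /andP[q0 q1] := q01.
have a0 : 0 <= a.
  by rewrite -[a]mulr1 -(expr0 q) (le_trans (rnorm_ge0 _) (xq 0)).
have q'0 : 0 < 1 - q by rewrite subr_gt0.
have xS n k : rnorm (x (n + k)%N - x n) <= a * q ^+ n * (1 - q ^+ k) / (1 - q).
  elim: k => [|k IH].
    by rewrite addn0 subrr rnorm0 expr0 subrr mulr0 mul0r.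
  rewrite addnS (le_trans (rdistD (x (n + k)%N) _ _))//.
  rewrite (le_trans (lerD (xq _) IH))// le_eqVlt; apply/orP; left; apply/eqP.
  by rewrite exprD exprS; field; exact: lt0r_neq0.
have xD n k : rnorm (x (n + k)%N - x n) <= a * q ^+ n / (1 - q).
  rewrite (le_trans (xS n k))// ler_pM2r ?invr_gt0//.
  by rewrite ler_piMr ?mulr_ge0 ?exprn_ge0// gerBl exprn_ge0.
have [|l xl] := @cauchy_seq_lim _ _ _ x.
  move=> e e0; have e20 := divr_gt0 e0 (@ltr0Sn R 1).
  have [N aN] := geometric_small (a / (1 - q)) q01 e20.
  exists N => m n /subnKC <- /subnKC <-.
  rewrite (le_lt_trans (rdistD (x N) _ _))// (rdistC (x N)).
  move: (xD N (m - N)%N) (xD N (n - N)%N); rewrite mulrAC in aN; lra.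
exists l => // n; apply/ler_addgt0Pl => e e0.
have [N xN] := xl e e0.
rewrite (le_trans (rdistD (x (n + N)%N) _ _))// lerD//.
by rewrite rdistC ltW// xN// leq_addl.
Qed.

Lemma seq_lim_rinner_le x l v c :
  seq_lim x l ->
  (forall e, 0 < e -> exists N, forall n, (N <= n)%N -> rinner (x n) v <= c + e) ->
  rinner l v <= c.
Proof.
move=> xl xc; apply/ler_addgt0Pr => e e0.
have e20 : 0 < e / 2 by rewrite divr_gt0.
have [N1 xN1] := xc _ e20.
have v0 : 0 < rnorm v + 1 by rewrite ltr_wpDl ?rnorm_ge0.
have [N2 xN2] := xl (e / 2 / (rnorm v + 1)) (divr_gt0 e20 v0).
pose n := maxn N1 N2.
have := xN1 n (leq_maxl _ _); have := xN2 n (leq_maxr _ _).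
rewrite ltr_pdivlMr// rdistC => d1 d2.
have := rinner_le (l - x n) v; rewrite rinnerBl.
have := rnorm_ge0 (l - x n); nra.
Qed.

Definition real_subspace (V : set H) :=
  [/\ V 0, forall u v, V u -> V v -> V (u + v) & forall a u, V u -> V (a%:C *: u)].

(** A minimizing sequence for the distance to [V] is Cauchy by the
    parallelogram law, and its limit is the foot of the perpendicular. *)
Lemma orthogonal_projection (V : set H) u :
  real_subspace V -> (forall x l, (forall n, V (x n)) -> seq_lim x l -> V l) ->
  exists2 w, V w & forall v, V v -> rinner (u - w) v = 0.
Proof.
move=> [V0 VD VZ] Vlim.
pose D := [set rnorm (u - v) ^+ 2 | v in V].
have lbD : lbound D 0 by move=> _ [v _ <-]; rewrite exprn_ge0 ?rnorm_ge0.
have hiD : has_inf D by split; [exists (rnorm (u - 0) ^+ 2), 0|exists 0].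
pose d := inf D.
have dle v : V v -> d <= rnorm (u - v) ^+ 2.
  by move=> Vv; apply: ge_inf; [exists 0|exists v].
have /choice[x xP] n : exists v, V v /\ rnorm (u - v) ^+ 2 < d + n.+1%:R^-1.
  have n0 : 0 < n.+1%:R^-1 :> R by rewrite invr_gt0.
  have [_ [v Vv <-] vd] := inf_adherent n0 hiD.
  by exists v; split.
have [l xl] : exists l, seq_lim x l.
  apply: cauchy_seq_lim => e e0.
  have [|N NP] := @invS_small (e ^+ 2 / 4); first by rewrite divr_gt0 ?exprn_gt0.
  exists N => m n Nm Nn; rewrite -(@ltr_pXn2r _ 2)// ?nnegrE ?rnorm_ge0 ?ltW//.
  have [Vm dm] := xP m; have [Vn dn] := xP n.
  have := dle _ (VZ 2^-1 _ (VD _ _ Vm Vn)).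
  have -> : u - 2^-1%:C *: (x m + x n) = 2^-1%:C *: ((u - x m) + (u - x n)).
    rewrite addrACA -opprD scalerBr; congr (_ - _).
    rewrite scalerDr -scalerDl -rmorphD (_ : 2^-1 + 2^-1 = 1); last by lra.
    by rewrite rmorph1 scale1r.
  have -> : x m - x n = (u - x n) - (u - x m) by rewrite opprB [RHS]addrC addrA subrK.
  rewrite rnormZr exprMn (rnormD_sqr (u - x m)) (rnormB_sqr (u - x n) (u - x m)).
  rewrite ger0_norm// (rinnerC (u - x n)); move: dm dn (NP _ Nm) (NP _ Nn).
  by move: (m.+1%:R^-1) (n.+1%:R^-1) => im in_; clear; lra.
exists l; first by apply: Vlim xl => n; have [] := xP n.
have xul : seq_lim (fun n => u - x n) (u - l).
  move=> e e0; have [N xN] := xl e e0; exists N => n /xN.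
  have -> : u - x n - (u - l) = l - x n by rewrite opprB addrC addrA subrK.
  by rewrite rdistC.
have le0 v : V v -> rinner (u - l) v <= 0.
  move=> Vv; apply/ler_addgt0Pr => e e0; rewrite add0r.
  apply: (seq_lim_rinner_le xul) => e' e'0.
  pose s := e / (rnorm v ^+ 2 + 1).
  have v0 : 0 < rnorm v ^+ 2 + 1 by rewrite ltr_wpDl ?exprn_ge0 ?rnorm_ge0.
  have s0 : 0 < s by rewrite divr_gt0.
  have sv : s * rnorm v ^+ 2 <= e.
    rewrite /s -mulrAC ler_pdivrMr// ler_pM2l//; lra.
  have [|N NP] := @invS_small (s * e'); first by rewrite mulr_gt0.
  exists N => n Nn; have [Vn dn] := xP n.
  (* Comparing the distances from [u] to [x n] and to [x n + s v]. *)
  have := dle _ (VD _ _ Vn (VZ s _ Vv)).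
  rewrite opprD addrA rnormB_sqr rinnerZr rnormZr (ger0_norm (ltW s0)).
  have ssv : s * (s * rnorm v ^+ 2) <= s * e by rewrite ler_pM2l.
  move=> dv; suff : s * (2 * rinner (u - x n) v) <= s * (e + e').
    by rewrite ler_pM2l//; lra.
  move: dn (NP _ Nn) dv ssv; move: (n.+1%:R^-1) => c; clear; lra.
move=> v Vv; apply/eqP; rewrite eq_le le0//= -oppr_le0 -rinnerNr le0//.
by rewrite -scaleN1r -(rmorph1 (real_complex R)) -rmorphN; exact: VZ.
Qed.

(** Riesz representation: the kernel of a nonzero bounded functional has a
    nonzero orthogonal vector, and that vector represents it up to a factor. *)
Lemma riesz (f : H -> R) (C : R) :
  (forall u v, f (u + v) = f u + f v) -> (forall a u, f (a%:C *: u) = a * f u) ->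
  (forall u, `|f u| <= C * rnorm u) -> exists z, forall u, f u = rinner u z.
Proof.
move=> fD fZ fC.
have [[u fu]|f0] := pselect (exists u, f u != 0); last first.
  exists 0 => u; rewrite rinner0r; apply/eqP/negPn/negP => fu; apply: f0.
  by exists u.
have f0 : f 0 = 0 by rewrite -(scale0r u) -(rmorph0 (real_complex R)) fZ mul0r.
have fB v w : f (v - w) = f v - f w.
  rewrite fD -scaleN1r -(rmorph1 (real_complex R)) -rmorphN fZ.
  by rewrite mulN1r.
have [|x l xf xl|w fw wV] := @orthogonal_projection [set v | f v = 0] u.
- split=> //= [v w fv fw|a v fv]; first by rewrite fD fv fw addr0.
  by rewrite fZ fv mulr0.
- apply/eqP; rewrite -normr_eq0 eq_le normr_ge0 andbT.
  apply/ler_addgt0Pr => e e0; rewrite add0r.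
  have C0 : 0 < `|C| + 1 by rewrite ltr_wpDl.
  have [N xN] := xl _ (divr_gt0 e0 C0).
  have := xN N (leqnn _); rewrite ltr_pdivlMr// => xNe.
  have := fC (x N - l); rewrite fB xf sub0r normrN => /le_trans; apply.
  rewrite (le_trans _ (ltW xNe))// mulrC ler_wpM2l ?rnorm_ge0//.
  by rewrite (le_trans (ler_norm _))// lerDl.
pose z := u - w.
have fz : f z = f u by rewrite fB fw subr0.
have z0 : 0 < rnorm z ^+ 2.
  rewrite exprn_gt0// rnorm_gt0; apply: contra fu => /eqP z0.
  by rewrite -fz z0 f0.
exists ((f u / rnorm z ^+ 2)%:C *: z) => v.
have : rinner z (v - (f v / f u)%:C *: z) = 0.
  by apply: wV; rewrite /= fB fZ fz divfK ?subrr.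
rewrite rinnerBr rinnerZr rinnerxx => /eqP; rewrite subr_eq0 => /eqP zv.
rewrite rinnerZr (rinnerC v) zv; field.
by rewrite fu -(sqrf_eq0 (rnorm z)) gt_eqF.
Qed.

Lemma rinner_inj u v : (forall w, rinner w u = rinner w v) -> u = v.
Proof.
move=> uv; apply/eqP; rewrite -subr_eq0; apply/eqP/rnorm_eq0/eqP.
by rewrite -sqrf_eq0 -rinnerxx rinnerBr uv subrr.
Qed.

Lemma inner_inj u v : (forall w, '[w, u] = '[w, v]) -> u = v.
Proof. by move=> uv; apply: rinner_inj => w; rewrite /rinner uv. Qed.

(** For a complex-linear operator an adjoint for the real inner product is an
    adjoint for the complex one. *)
Lemma rinner_adjoint (T S : H -> H) : linear T ->
  (forall u v, rinner (T u) v = rinner u (S v)) ->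
  forall u v, '[T u, v] = '[u, S v].
Proof. by move=> lT TS u v; rewrite !innerE -(linZE lT) !TS. Qed.

Lemma adjoint_unique (T S : H -> H) :
  (forall u v, '[T u, v] = '[u, S v]) -> adjoint T = S.
Proof.
move=> TS; apply/funext => v; apply: inner_inj => u; rewrite -TS.
by rewrite /adjoint; case: xgetP => [A _ /= ->//|/(_ S)/= /(_ TS)].
Qed.

Lemma adjoint_exists (T : H -> H) : bounded_op T ->
  exists S, forall u v, rinner (T u) v = rinner u (S v).
Proof.
move=> /bounded_opP[lT [C C0 TC]].
have /choice[S TS] v : exists z, forall u, rinner (T u) v = rinner u z.
  apply: (@riesz _ (C * rnorm v)) => [u w|a u|u].
  - by rewrite (linDE lT) rinnerDl.
  - by rewrite (linZE lT) rinnerZl.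
  - rewrite (le_trans (normr_rinner_le _ _))// mulrAC ler_wpM2r ?rnorm_ge0//.
by exists S => u v; exact: TS.
Qed.

Lemma inner_adjoint (T : H -> H) u v : bounded_op T ->
  '[T u, v] = '[u, adjoint T v].
Proof.
move=> bT; have [S TS] := adjoint_exists bT.
have {}TS := rinner_adjoint bT.1 TS.
by rewrite (adjoint_unique TS).
Qed.

Lemma rinner_adjointE (T : H -> H) u v : bounded_op T ->
  rinner (T u) v = rinner u (adjoint T v).
Proof. by move=> bT; rewrite /rinner inner_adjoint. Qed.

Lemma adjoint_bounded (T : H -> H) : bounded_op T -> bounded_op (adjoint T).
Proof.
move=> bT; have /bounded_opP[lT [C C0 TC]] := bT.
apply/bounded_opP; split.
  move=> c u v; apply: inner_inj => w.
  rewrite -inner_adjoint// !linearDr/= !linearZr_LR/= !inner_adjoint//.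
exists C => // u; have [->|u0] := eqVneq (adjoint T u) 0.
  by rewrite rnorm0 mulr_ge0 ?rnorm_ge0.
rewrite -rnorm_gt0 in u0; rewrite -(ler_pM2l u0) -expr2 -rinnerxx.
rewrite -rinner_adjointE// (le_trans (rinner_le _ _))//.
by rewrite mulrCA mulrA ler_wpM2r ?rnorm_ge0.
Qed.

(** Lax-Milgram: [u |-> u - g (T u - v)] is a contraction for small [g > 0],
    and its fixed point solves [T u = v]. *)
Lemma coercive_invertible (T : H -> H) (d : R) : bounded_op T -> 0 < d ->
  (forall u, d * rnorm u ^+ 2 <= rinner (T u) u) ->
  exists S, [/\ bounded_op S, T \o S = id & S \o T = id].
Proof.
move=> /bounded_opP[lT [C C0 TC]] d0 Td.
have Tlow u : d * rnorm u <= rnorm (T u).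
  have [->|] := eqVneq u 0; first by rewrite rnorm0 mulr0 rnorm_ge0.
  rewrite -rnorm_gt0 => u0; rewrite -(ler_pM2r u0) -mulrA -expr2.
  by rewrite (le_trans (Td u))// rinner_le.
have Tinj : injective T.
  move=> u v uv; apply/eqP; rewrite -subr_eq0; apply/eqP/rnorm_eq0/eqP.
  have := Tlow (u - v); rewrite (linBE lT) uv subrr rnorm0.
  by rewrite pmulr_rle0// eq_le rnorm_ge0 andbT.
pose K := C + d; have K0 : 0 < K by rewrite ltr_wpDl.
have dK : d / K <= 1 by rewrite ler_pdivrMr// mul1r lerDr.
have dK0 : 0 < d / K by rewrite divr_gt0.
pose g := d / K ^+ 2; have g0 : 0 < g by rewrite divr_gt0 ?exprn_gt0.
(* [q ^+ 2] dominates the factor [1 - d ^+ 2 / K ^+ 2] by which the iteration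
   contracts squared norms. *)
pose q := 1 - (d / K) ^+ 2 / 2.
have q01 : 0 <= q < 1 by rewrite /q; apply/andP; split; nra.
have contr u : rnorm (u - g%:C *: T u) <= q * rnorm u.
  have /andP[q0 _] := q01.
  rewrite -(@ler_pXn2r _ 2)// ?nnegrE ?mulr_ge0 ?rnorm_ge0//.
  rewrite rnormB_sqr rinnerZr rnormZr rinnerC gtr0_norm//.
  rewrite (exprMn_comm 2 (mulrC q _)) (exprMn_comm 2 (mulrC g _)).
  have gK : g * K ^+ 2 = d by rewrite /g divfK// sqrf_eq0 gt_eqF.
  have gd : g * d = (d / K) ^+ 2 by rewrite /g exprMn exprVn; ring.
  have TK : rnorm (T u) ^+ 2 <= K ^+ 2 * rnorm u ^+ 2.
    rewrite -exprMn ler_pXn2r// ?nnegrE ?mulr_ge0 ?rnorm_ge0//; last exact: ltW.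
    by rewrite (le_trans (TC u))// ler_wpM2r ?rnorm_ge0// lerDl ltW.
  have TK' : g ^+ 2 * rnorm (T u) ^+ 2 <= (d / K) ^+ 2 * rnorm u ^+ 2.
    rewrite (le_trans (ler_wpM2l (exprn_ge0 2 (ltW g0)) TK))//.
    have -> : g ^+ 2 * (K ^+ 2 * rnorm u ^+ 2) = g * (g * K ^+ 2) * rnorm u ^+ 2.
      by ring.
    by rewrite gK gd.
  have gT : (d / K) ^+ 2 * rnorm u ^+ 2 <= g * rinner (T u) u.
    by rewrite -gd -mulrA ler_pM2l.
  move: gT TK'; rewrite /q; move: ((d / K) ^+ 2) => D gT TK'.
  have := sqr_ge0 (D * rnorm u). by move: gT TK'; clear; lra.
have Tsurj v : exists l, T l = v.
  have [x xE] : exists x, forall m, x m.+1 - x m = - (g%:C *: (T (x m) - v)).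
    exists (fun n => iter n (fun u => u - g%:C *: (T u - v)) 0) => m.
    by rewrite iterS addrAC subrr add0r.
  have xS n : rnorm (x n.+1 - x n) <= rnorm (x 1%N - x 0%N) * q ^+ n.
    elim: n => [|n IH]; first by rewrite expr0 mulr1.
    have -> : x n.+2 - x n.+1 = (x n.+1 - x n) - g%:C *: T (x n.+1 - x n).
      rewrite (linBE lT) (xE n.+1) (xE n) -opprD -scalerDr; congr (- (_ *: _)).
      by rewrite [RHS]addrC addrA subrK.
    rewrite (le_trans (contr _))// exprS mulrCA ler_wpM2l//.
    by case/andP: q01.
  have [l xl _] := geometric_seq_lim q01 xS.
  exists l; apply/eqP; rewrite -subr_eq0; apply/eqP/rnorm_eq0/eqP.
  rewrite eq_le rnorm_ge0 andbT; apply/ler_addgt0Pr => e e0; rewrite add0r.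
  rewrite -(ler_pM2l g0).
  pose e' := g * e / (g * K + 2).
  have gK0 : 0 < g * K + 2 by have := mulr_gt0 g0 K0; lra.
  have e'0 : 0 < e' := divr_gt0 (mulr_gt0 g0 e0) gK0.
  have [N xN] := xl _ e'0.
  have x1 := xN _ (leqnn N); have x2 := xN _ (leqnSn N).
  have := rnormZr g (T l - v); rewrite gtr0_norm// => <-.
  have -> : g%:C *: (T l - v) = g%:C *: T (l - x N) - ((x N.+1 - l) + (l - x N)).
    by rewrite addrA subrK xE opprK (linBE lT) -scalerDr addrA subrK.
  rewrite (le_trans (rnormB _ _))// rnormZr gtr0_norm//.
  have := rnormD (x N.+1 - l) (l - x N).
  have := TC (l - x N); rewrite (rdistC l) => TxN.
  have gT : g * rnorm (T (l - x N)) <= g * K * e'.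
    rewrite -mulrA ler_pM2l// (le_trans TxN)// ler_pM ?rnorm_ge0//; last exact: ltW.
    by rewrite lerDl ltW.
  have : e' * (g * K + 2) = g * e by rewrite /e' divfK// gt_eqF.
  lra.
have /choice[S TS] := Tsurj.
exists S; split.
- apply/bounded_opP; split=> [c u v|].
    by apply: Tinj; rewrite (linDE lT) (linZE lT) !TS.
  exists d^-1 => [|u]; first by rewrite invr_ge0 ltW.
  by rewrite mulrC ler_pdivlMr// mulrC -{2}(TS u) Tlow.
- exact/funext.
- by apply/funext => u; apply: Tinj; rewrite /= TS.
Qed.

End Completeness.
(** * Moore-Penrose inverses *)

Section UniformBoundedness.
Variables (R : realType) (X : Type) (H : rkhs R X).
Implicit Types (u v w z : H) (x : nat -> H).

(** The uniform boundedness principle by a gliding hump: if [Z] were unbounded,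
    steps of length [3^-n] along fast growing elements [z n] of [Z] would lead
    to a point whose inner products with the [z n] are unbounded. *)
Lemma uniform_boundedness (Z : set H) :
  (forall w, exists C, forall z, Z z -> `|rinner w z| <= C) ->
  exists C, forall z, Z z -> rnorm z <= C.
Proof.
move=> Zpt; apply: contrapT => Zunb.
have /choice[z zP] n : exists z, Z z /\ 2 * n%:R * 3 ^+ n < rnorm z.
  apply: contrapT => noz; apply: Zunb; exists (2 * n%:R * 3 ^+ n) => z Zz.
  by rewrite leNgt; apply/negP => nz; apply: noz; exists z.
have z0 n : 0 < rnorm (z n).
  by apply: le_lt_trans (zP n).2; rewrite !mulr_ge0 ?exprn_ge0.
(* The sign of each step is chosen so that it does not decrease the modulus of
   the inner product with [z n]. *)
pose s n u : R := if 0 <= rinner u (z n) then 1 else -1.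
pose step n u : H := (s n u * 3^-1 ^+ n / rnorm (z n))%:C *: z n.
have sN n u : `|s n u| = 1 by rewrite /s; case: ifP; rewrite ?normrN normr1.
pose x := fix x n := if n is m.+1 then x m + step m (x m) else 0.
have xS n : rnorm (x n.+1 - x n) <= 1 * 3^-1 ^+ n.
  rewrite /= addrAC subrr add0r rnormZr !normrM sN !mul1r normrV ?unitfE ?gt_eqF//.
  by rewrite (gtr0_norm (z0 n)) divfK ?gt_eqF// ger0_norm ?exprn_ge0.
have q01 : 0 <= (3^-1 : R) < 1 by rewrite invr_ge0 ler0n/= invf_lt1// ltr1n.
have [l _ lx] := geometric_seq_lim q01 xS.
have hump n : 3^-1 ^+ n * rnorm (z n) <= `|rinner (x n.+1) (z n)|.
  rewrite /= rinnerDl rinnerZl rinnerxx.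
  have -> : s n (x n) * 3^-1 ^+ n / rnorm (z n) * rnorm (z n) ^+ 2 =
      s n (x n) * (3^-1 ^+ n * rnorm (z n)).
    by move: (3^-1 ^+ n) => t; field; exact: lt0r_neq0 (z0 n).
  have : 0 <= 3^-1 ^+ n * rnorm (z n) by rewrite mulr_ge0 ?exprn_ge0 ?rnorm_ge0.
  rewrite /s; case: (leP 0 (rinner (x n) (z n))) => h t0.
    by rewrite /= mul1r ger0_norm ?addr_ge0// lerDr.
  by rewrite /= mulN1r -normrN ger0_norm; lra.
have big n : n%:R <= `|rinner l (z n)|.
  have h1 := hump n.
  have h2 := normr_rinner_le (l - x n.+1) (z n); rewrite rinnerBl in h2.
  have h3 : `|rinner (x n.+1) (z n)| <=
      `|rinner l (z n)| + `|rinner l (z n) - rinner (x n.+1) (z n)|.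
    by rewrite -{1}[rinner (x n.+1) (z n)](subKr (rinner l (z n))) ler_normB.
  have h4 : rnorm (l - x n.+1) * rnorm (z n) <= 3^-1 ^+ n / 2 * rnorm (z n).
    rewrite ler_wpM2r ?rnorm_ge0// (le_trans (lx n.+1))// le_eqVlt.
    by apply/orP; left; apply/eqP; rewrite exprS; field.
  have h5 : n%:R <= 3^-1 ^+ n * rnorm (z n) / 2.
    have := (zP n).2; rewrite -ltr_pdivlMr ?exprn_gt0// exprVn.
    by rewrite (mulrC _^-1); move: (rnorm (z n) / 3 ^+ n) => y; lra.
  lra.
have [C Cl] := Zpt l.
have := Cl _ (zP (Num.truncn C).+1).1; apply/negP; rewrite -ltNge.
exact: lt_le_trans (truncnS_gt _) (big _).
Qed.

End UniformBoundedness.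

Section BoundedOperators.
Variables (R : realType) (X : Type) (H : rkhs R X).

Lemma bounded_opD (A B : H -> H) : bounded_op A -> bounded_op B -> bounded_op (A + B).
Proof.
move=> /bounded_opP[lA [a a0 aA]] /bounded_opP[lB [b b0 bB]]; apply/bounded_opP.
split=> [c u v|]; first by rewrite !fctE lA lB scalerDr addrACA.
exists (a + b) => [|u]; first exact: addr_ge0.
by rewrite fctE (le_trans (rnormD _ _))// mulrDl lerD.
Qed.

Lemma bounded_opZ (c : R[i]) (A : H -> H) : bounded_op A -> bounded_op (c *: A).
Proof.
move=> /bounded_opP[lA [a a0 aA]]; apply/bounded_opP.
split=> [d u v|]; first by rewrite !fctE lA scalerDr !scalerA mulrC.
have c0 := Re_norm_ge0 c.
exists (complex.Re `|c| * a) => [|u]; first exact: mulr_ge0.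
by rewrite fctE rnormZ -mulrA ler_wpM2l.
Qed.

Lemma bounded_op_comp (A B : H -> H) :
  bounded_op A -> bounded_op B -> bounded_op (A \o B).
Proof.
move=> /bounded_opP[lA [a a0 aA]] /bounded_opP[lB [b b0 bB]]; apply/bounded_opP.
split=> [c u v|]; first by rewrite /= lB lA.
exists (a * b) => [|u]; first exact: mulr_ge0.
by rewrite /= (le_trans (aA _))// -mulrA ler_wpM2l.
Qed.

Lemma bounded_op_id : bounded_op (@id H).
Proof. by apply/bounded_opP; split=> //; exists 1 => // u; rewrite mul1r. Qed.

End BoundedOperators.

Section ClosedRange.
Variables (R : realType) (X : Type) (H : rkhs R X) (M : H -> H).
Hypotheses (bM : bounded_op M) (cM : closed (range M)).
Implicit Types (u v w z : H).
Let lM := bM.1.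

(** The orthogonal projection onto the range of [M]. *)
Lemma range_projection : exists P : H -> H,
  [/\ bounded_op P, forall u, range M (P u), forall u, P (M u) = M u,
      forall u v, rinner (P u) v = rinner u (P v) &
      forall u, rnorm u ^+ 2 = rnorm (P u) ^+ 2 + rnorm (u - P u) ^+ 2].
Proof.
have rD u v : range M u -> range M v -> range M (u + v).
  by move=> [u' _ <-] [v' _ <-]; exists (u' + v'); rewrite // (linDE lM).
have rZ (c : R[i]) u : range M u -> range M (c *: u).
  by move=> [u' _ <-]; exists (c *: u'); rewrite // (linZE lM).
have /choice[P PP] u : exists w,
    range M w /\ forall v, range M v -> rinner (u - w) v = 0.
  have [|x l xM xl|w Mw wP] := @orthogonal_projection _ _ _ (range M) u.
  - by split=> // [|a v]; [exists 0; rewrite // (lin0 lM)|exact: rZ].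
  - exact: closed_seq_lim xl.
  - by exists w.
have Puniq u w : range M w -> (forall v, range M v -> rinner (u - w) v = 0) -> P u = w.
  move=> Mw wP; have [MP Pu] := PP u.
  have Mr : range M (P u - w) by apply: rD => //; rewrite -scaleN1r; exact: rZ.
  apply/eqP; rewrite -subr_eq0; apply/eqP/rnorm_eq0/eqP; rewrite -sqrf_eq0.
  have E : P u - w = (u - w) - (u - P u) by rewrite opprB [RHS]addrC addrA subrK.
  by rewrite -rinnerxx {1}E rinnerBl (Pu _ Mr) (wP _ Mr) subrr.
have Pself u v : rinner (P u) v = rinner (P u) (P v).
  have := (PP v).2 _ (PP u).1.
  by rewrite rinnerBl (rinnerC v) (rinnerC (P v)) => /eqP; rewrite subr_eq0 => /eqP.
have pyth u : rnorm u ^+ 2 = rnorm (P u) ^+ 2 + rnorm (u - P u) ^+ 2.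
  have := rnormD_sqr (u - P u) (P u); rewrite subrK => ->.
  by rewrite ((PP u).2 _ (PP u).1); ring.
exists P; split=> //.
- apply/bounded_opP; split.
    move=> c u v; apply: Puniq => [|w Mw].
      by apply: rD (PP v).1; apply: rZ (PP u).1.
    have -> : c *: u + v - (c *: P u + P v) = c *: (u - P u) + (v - P v).
      by rewrite scalerBr opprD addrACA.
    rewrite rinnerDl ((PP v).2 _ Mw) addr0.
    (* Orthogonality to a complex subspace is also orthogonality for the complex
       inner product. *)
    have i0 : rinner ('i%C *: (u - P u)) w = 0.
      have := (PP u).2 _ (rZ (- 'i%C) _ Mw); rewrite /rinner linearZr_LR linearZl_LR/=.
      move=> h; rewrite -[RHS]h; congr (complex.Re (_ * _)).
      by apply/eqP; rewrite eq_complex/= oppr0 !opprK !eqxx.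
    by rewrite /rinner linearZl_LR/= innerE i0 ((PP u).2 _ Mw) oppr0 mulr0.
  exists 1 => // u; rewrite mul1r -(@ler_pXn2r _ 2)// ?nnegrE ?rnorm_ge0//.
  by rewrite (pyth u) lerDl exprn_ge0// rnorm_ge0.
- by move=> u; exact: (PP u).1.
- by move=> u; apply: Puniq => [|w _]; [exists u|rewrite subrr rinner0l].
- by move=> u v; rewrite Pself rinnerC -Pself rinnerC.
Qed.

(** By uniform boundedness applied to the elements [z] of the range of [M] with
    [|M^* z| <= 1]: for fixed [w] the projection of [w] is some [M v], so that
    [<w, z> = <v, M^* z>] is bounded by [|v|]. *)
Lemma adjoint_bounded_below :
  exists2 C, 1 <= C & forall z, range M z -> rnorm z <= C * rnorm (adjoint M z).
Proof.
have [P [bP PM PMM Psym _]] := range_projection.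
have bA := adjoint_bounded bM.
have [w|C CZ] := @uniform_boundedness _ _ _
    [set z | range M z /\ rnorm (adjoint M z) <= 1].
  have [v _ Mv] := PM w; exists (rnorm v) => z [[z' _ Mz] Az].
  rewrite -Mz -PMM -Psym Mz -Mv (rinner_adjointE _ _ bM).
  by rewrite (le_trans (normr_rinner_le _ _))// ler_piMr// rnorm_ge0.
exists (Num.max C 1) => [|z Mz]; first by rewrite le_max lexx orbT.
have [Az0|] := eqVneq (adjoint M z) 0.
  have [v _ Mv] := Mz.
  suff -> : z = 0 by rewrite rnorm0 mulr_ge0 ?rnorm_ge0// le_max ler01 orbT.
  apply/rnorm_eq0/eqP; rewrite -sqrf_eq0 -rinnerxx -{1}Mv.
  by rewrite (rinner_adjointE _ _ bM) Az0 rinner0r.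
rewrite -rnorm_gt0 => Az0; rewrite -ler_pdivrMr//.
have : rnorm ((rnorm (adjoint M z))^-1%:C *: z) <= C.
  apply: CZ; split.
    have [v _ <-] := Mz; exists ((rnorm (adjoint M (M v)))^-1%:C *: v) => //.
    exact: (linZE lM).
  rewrite (linZE bA.1) rnormZr ger0_norm ?invr_ge0 ?rnorm_ge0//.
  by rewrite mulVf// gt_eqF.
rewrite rnormZr ger0_norm ?invr_ge0 ?rnorm_ge0// mulrC => /le_trans; apply.
by rewrite le_max lexx.
Qed.

(** [M M^* + (1 - P)], with [P] the projection onto the range of [M], is coercive;
    with [S] its inverse, [M^* S] is the Moore-Penrose inverse. *)
Lemma moore_penrose_exists : exists S, is_moore_penrose M S.
Proof.
have [P [bP PM PMM Psym pyth]] := range_projection.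
have [C C1 CM] := adjoint_bounded_below.
have C0 : 0 < C by exact: lt_le_trans C1.
have bA := adjoint_bounded bM.
set A := adjoint M in CM bA *.
have MA u v : rinner (M u) v = rinner u (A v) by exact: rinner_adjointE.
have AM u v : rinner (A u) v = rinner u (M v) by rewrite rinnerC -MA rinnerC.
have AP u : A (P u) = A u.
  by apply: rinner_inj => w; rewrite -!MA -Psym PMM.
have PP u : P (P u) = P u by have [v _ <-] := PM u.
pose T : H -> H := (M \o A) + (id + (-1) *: P).
have TE u : T u = M (A u) + (u - P u) by rewrite /T !fctE/= scaleN1r.
have bT : bounded_op T.
  apply: bounded_opD; first exact: bounded_op_comp.
  by apply: bounded_opD; [exact: bounded_op_id|exact: bounded_opZ].
have lT := bT.1.
have Tcoer u : (C ^+ 2)^-1 * rnorm u ^+ 2 <= rinner (T u) u.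
  have Puu : rinner (u - P u) u = rnorm (u - P u) ^+ 2.
    rewrite rnormB_sqr rinnerBl rinnerxx -(rinnerxx (P u)) (Psym u u).
    by rewrite (Psym u (P u)) PP; ring.
  rewrite TE rinnerDl MA rinnerxx Puu (pyth u) mulrDr -AP lerD//.
    rewrite mulrC ler_pdivrMr ?exprn_gt0// -exprMn mulrC.
    by rewrite ler_pXn2r ?nnegrE ?mulr_ge0 ?rnorm_ge0 ?(ltW C0)// CM.
  rewrite ler_piMl ?exprn_ge0 ?rnorm_ge0//.
  by rewrite invf_le1 ?exprn_gt0// exprn_ege1.
have C2 : 0 < (C ^+ 2)^-1 by rewrite invr_gt0 exprn_gt0.
have [S [bS TS ST]] := coercive_invertible bT C2 Tcoer.
have {}TS u : T (S u) = u := congr1 (@^~ u) TS.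
have {}ST u : S (T u) = u := congr1 (@^~ u) ST.
have Tsym u v : rinner (T u) v = rinner u (T v).
  rewrite !TE !rinnerDl !rinnerDr MA AM !rinnerNl !rinnerNr Psym; ring.
have Ssym u v : rinner (S u) v = rinner u (S v).
  by rewrite -{1}(TS v) -Tsym TS.
have PT u : P (T u) = M (A u).
  by rewrite TE (linDE bP.1) (linBE bP.1) PP subrr addr0 PMM.
have TP u : T (P u) = M (A u) by rewrite TE AP PP subrr addr0.
have PS u : P (S u) = S (P u) by rewrite -[LHS]ST TP -PT TS.
have MAS u : M (A (S u)) = P u by rewrite -PT TS.
exists (A \o S); split.
- exact: bounded_op_comp.
- by apply/funext => u; rewrite /= MAS PMM.
- by apply/funext => u; rewrite /= MAS -PS AP.
- apply: adjoint_unique; apply: rinner_adjoint.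
    by apply: (bounded_op_comp bM (bounded_op_comp bA bS)).1.
  by move=> u v; rewrite /= !MAS Psym.
- apply: adjoint_unique; apply: rinner_adjoint.
    by apply: (bounded_op_comp (bounded_op_comp bA bS) bM).1.
  by move=> u v; rewrite /= AM Ssym -MA.
Qed.

Lemma moore_penrose_projection (P := M \o moore_penrose M) :
  [/\ bounded_op P, forall u, P (M u) = M u, forall u, P (P u) = P u
    & forall u v, '[P u, v] = '[u, P v]].
Proof.
rewrite /P /moore_penrose; case: xgetP => [S _ /= [bS MSM SMS sMS sSM]|]; last first.
  by have [S MS] := moore_penrose_exists => /(_ S).
have PM u : M (S (M u)) = M u := congr1 (@^~ u) MSM.
have bMS := bounded_op_comp bM bS.
by split=> // u v; rewrite (inner_adjoint _ _ bMS) sMS.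
Qed.

End ClosedRange.
(** * Uniform approximation by polynomials *)

Section BernsteinPolynomials.
Variable R : realType.
Implicit Types (f : R -> R) (g h : nat -> R) (t : R).

(** The Bernstein polynomial [\sum_k g k 'C(n, k) 'X^k (1 - 'X)^(n - k)], by the
    recursion that conditions the binomial distribution on its last trial; the
    estimates below then are inductions without binomial coefficients. *)
Fixpoint bernstein n g : {poly R} :=
  if n is m.+1 then (1 - 'X) * bernstein m g + 'X * bernstein m (fun k => g k.+1)
  else (g 0%N)%:P.

Lemma bernstein_horner n g t :
  (bernstein n.+1 g).[t] =
  (1 - t) * (bernstein n g).[t] + t * (bernstein n (fun k => g k.+1)).[t].
Proof. by rewrite /= !hornerE. Qed.

Lemma bernstein_le n g h t : 0 <= t <= 1 ->
  (forall k, (k <= n)%N -> g k <= h k) -> (bernstein n g).[t] <= (bernstein n h).[t].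
Proof.
move=> /andP[t0 t1]; elim: n g h => [|n IH] g h gh; first by rewrite !hornerC gh.
rewrite !bernstein_horner lerD// ler_wpM2l ?subr_ge0//.
  by apply: IH => k kn; apply: gh; exact: leqW.
by apply: IH => k kn; exact: gh.
Qed.

(** For [a = 0], [b = 1] and [c = n t] this is the variance [n t (1 - t)] of the
    binomial distribution. *)
Lemma bernstein_sqr n a b c t :
  (bernstein n (fun k => a + b * (k%:R - c) ^+ 2)).[t] =
  a + b * ((n%:R * t - c) ^+ 2 + n%:R * (t * (1 - t))).
Proof.
elim: n c => [|n IH] c; first by rewrite hornerC; ring.
have S : (fun k => a + b * (k.+1%:R - c) ^+ 2) =
          (fun k => a + b * (k%:R - (c - 1)) ^+ 2).
  by apply/funext => k; rewrite -natr1; ring.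
by rewrite bernstein_horner S !IH -natr1; ring.
Qed.

Definition unif_continuous_on (b : R) f :=
  forall e, 0 < e -> exists2 d, 0 < d & forall s t, 0 <= s <= b -> 0 <= t <= b ->
    `|s - t| < d -> `|f s - f t| < e.

Lemma weierstrass01 f K e : (forall t, 0 <= t <= 1 -> `|f t| <= K) ->
  unif_continuous_on 1 f -> 0 < e ->
  exists p : {poly R}, forall t, 0 <= t <= 1 -> `|p.[t] - f t| < e.
Proof.
move=> fK fc e0; have e20 : 0 < e / 2 by rewrite divr_gt0.
have [d d0 fd] := fc _ e20.
have K0 : 0 <= K by rewrite (le_trans _ (fK 0 _))// lexx ler01.
pose b := 2 * K / d ^+ 2.
have b0 : 0 <= b by rewrite !mulr_ge0// invr_ge0 exprn_ge0// ltW.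
pose n := (Num.truncn (b / (e / 2))).+1.
have n0 : 0 < n%:R :> R by rewrite ltr0n.
have bn : b / n%:R < e / 2.
  by rewrite ltr_pdivrMr// mulrC -ltr_pdivrMr// truncnS_gt.
exists (bernstein n (fun k => f (k%:R / n%:R))) => t t01.
have /andP[t0 t1] := t01.
(* Points far from [t] are controlled by the second moment, the others by the
   uniform continuity of [f]. *)
have dev k : (k <= n)%N ->
    `|f (k%:R / n%:R) - f t| <= e / 2 + b / n%:R ^+ 2 * (k%:R - n%:R * t) ^+ 2.
  move=> kn.
  have k01 : 0 <= (k%:R / n%:R : R) <= 1.
    by rewrite divr_ge0//= ler_pdivrMr// mul1r ler_nat.
  have -> : b / n%:R ^+ 2 * (k%:R - n%:R * t) ^+ 2 = b * (k%:R / n%:R - t) ^+ 2.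
    by field; exact: lt0r_neq0.
  have [/(fd _ _ k01 t01)/ltW h|h] := ltP (`|k%:R / n%:R - t|) d.
    by rewrite (le_trans h)// lerDl mulr_ge0 ?sqr_ge0.
  rewrite (le_trans (ler_normB _ _))// (le_trans (lerD (fK _ k01) (fK _ t01)))//.
  apply: (@le_trans _ _ (b * (k%:R / n%:R - t) ^+ 2)); last by rewrite lerDr ltW.
  have -> : K + K = 2 * K by ring.
  rewrite /b mulrAC ler_pdivlMr ?exprn_gt0//.
  rewrite ler_wpM2l ?mulr_ge0// -(real_normK (num_real (_ - t))).
  by rewrite ler_pXn2r ?nnegrE ?(ltW d0).
have ub : b / n%:R ^+ 2 * (n%:R * (t * (1 - t))) < e / 2.
  apply: le_lt_trans bn.
  have -> : b / n%:R ^+ 2 * (n%:R * (t * (1 - t))) = b / n%:R * (t * (1 - t)).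
    by field; exact: lt0r_neq0.
  rewrite ler_piMr ?divr_ge0//; nra.
rewrite ltr_norml; apply/andP; split.
- have : (bernstein n (fun k => (f t - e / 2) +
      (- (b / n%:R ^+ 2)) * (k%:R - n%:R * t) ^+ 2)).[t] <=
      (bernstein n (fun k => f (k%:R / n%:R))).[t].
    apply: bernstein_le => // k /dev; rewrite ler_norml => /andP[+ _]; lra.
  by rewrite bernstein_sqr subrr; lra.
- have : (bernstein n (fun k => f (k%:R / n%:R))).[t] <=
      (bernstein n (fun k => (f t + e / 2) +
      (b / n%:R ^+ 2) * (k%:R - n%:R * t) ^+ 2)).[t].
    apply: bernstein_le => // k /dev; rewrite ler_norml => /andP[_]; lra.
  by rewrite bernstein_sqr subrr; lra.
Qed.

Lemma weierstrass f b K e : 0 < b -> (forall t, 0 <= t <= b -> `|f t| <= K) ->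
  unif_continuous_on b f -> 0 < e ->
  exists p : {poly R}, forall t, 0 <= t <= b -> `|p.[t] - f t| < e.
Proof.
move=> b0 fK fc e0.
have b01 t : 0 <= t <= 1 -> 0 <= b * t <= b.
  by move=> /andP[t0 t1]; rewrite mulr_ge0 ?(ltW b0)//= ger_pMr.
have [|e' e'0|p pf] := @weierstrass01 (fun t => f (b * t)) K e _ _ e0.
- by move=> t /b01; exact: fK.
- have [d d0 fd] := fc _ e'0; exists (d / b); first exact: divr_gt0.
  move=> s t /b01 sb /b01 tb; rewrite ltr_pdivlMr// => st; apply: fd => //.
  by rewrite -mulrBr normrM gtr0_norm// mulrC.
exists (p \Po (b^-1 *: 'X)) => t /andP[t0 tb].
rewrite horner_comp !hornerE.
have := pf (b^-1 * t); rewrite mulrA divff ?gt_eqF// mul1r; apply.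
by rewrite mulr_ge0 ?invr_ge0 ?(ltW b0)//= mulrC ler_pdivrMr// mul1r.
Qed.

End BernsteinPolynomials.

(** * Real powers *)

Section Powers.
Variable R : realType.
Implicit Types (r s t c b : R).

(** Bernoulli's inequality, for a real exponent. *)
Lemma bernoulli_powR r t : 1 <= r -> 0 <= t -> 1 + r * (t - 1) <= t `^ r.
Proof.
rewrite le_eqVlt => /predU1P[<-|r1] t0; first by rewrite powRr1//; lra.
have r0 : 0 < r by apply: lt_trans r1.
(* Young's inequality for [t * 1], with exponents [r] and [q]. *)
pose q := (1 - r^-1)^-1.
have q0 : 0 < q by rewrite invr_gt0 subr_gt0 invf_lt1.
have rq : r^-1 + q^-1 = 1 by rewrite invrK; ring.
have := conjugate_powR t0 ler01 r0 q0 rq.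
rewrite powR1 mulr1 mul1r /q invrK => h.
have := ler_wpM2l (ltW r0) h.
have -> : r * (t `^ r / r + (1 - r^-1)) = t `^ r + r - 1 by field; exact: lt0r_neq0.
lra.
Qed.

(** Bernoulli's inequality for [t / c], scaled by [c `^ r]; the slope
    [r c `^ (r - 1)] is written without a difference in the exponent. *)
Lemma powR_tangent r c t : 1 <= r -> 0 < c -> 0 <= t ->
  c `^ r + r * (c `^ r / c) * (t - c) <= t `^ r.
Proof.
move=> r1 c0 t0.
have -> : t `^ r = c `^ r * (t / c) `^ r.
  by rewrite -powRM ?divr_ge0 ?(ltW c0)// mulrC divfK// gt_eqF.
have := ler_wpM2l (powR_ge0 c r) (bernoulli_powR r1 (divr_ge0 t0 (ltW c0))).
apply: le_trans; rewrite le_eqVlt; apply/orP; left; apply/eqP.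
by field; exact: lt0r_neq0.
Qed.

(** Add the tangent inequalities at the midpoint: their slopes cancel. *)
Lemma powR_midpoint r a b : 1 <= r -> 0 <= a -> 0 <= b ->
  ((a + b) / 2) `^ r <= (a `^ r + b `^ r) / 2.
Proof.
move=> r1 a0 b0; pose c := (a + b) / 2.
have [c0|c0] := leP c 0.
  have -> : a = 0 by move: c0; rewrite /c; lra.
  have -> : b = 0 by move: c0; rewrite /c; lra.
  by rewrite addr0 mul0r powR0 ?addr0 ?mul0r// gt_eqF// (lt_le_trans ltr01).
have := powR_tangent r1 c0 a0; have := powR_tangent r1 c0 b0.
have : r * (c `^ r / c) * (b - c) + r * (c `^ r / c) * (a - c) = 0.
  by rewrite -mulrDr (_ : b - c + (a - c) = 0) ?mulr0// /c; field.
rewrite -/c; lra.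
Qed.

(** By the tangent inequality, [t |-> t `^ r] is Lipschitz on bounded intervals. *)
Lemma powR_unif_continuous r b : 1 <= r -> unif_continuous_on b (fun t => t `^ r).
Proof.
move=> r1 e e0.
pose L := r * `|b| `^ (r - 1) + 1.
have r0 : 0 < r by apply: lt_le_trans r1.
have L0 : 0 < L by rewrite ltr_wpDl// mulr_ge0 ?powR_ge0 ?(ltW r0).
have lip s t : 0 <= s -> s <= t -> t <= b -> t `^ r - s `^ r <= L * (t - s).
  move=> s0 st tb.
  have [t0|t0] := leP t 0.
    have -> : s = t by lra. by rewrite !subrr mulr0 lexx.
  have := powR_tangent r1 t0 s0.
  have -> : t `^ r / t = t `^ (r - 1).
    by rewrite -(mulr_powRB1 (ltW t0) r0) mulrC mulKf// gt_eqF.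
  have : t `^ (r - 1) <= `|b| `^ (r - 1).
    apply: ge0_ler_powR; rewrite ?subr_ge0 ?nnegrE ?(ltW t0)//.
    exact: le_trans (ler_norm b).
  move=> /(ler_wpM2l (ltW r0)) h1 h2.
  have : r * t `^ (r - 1) * (t - s) <= L * (t - s).
    by rewrite ler_wpM2r ?subr_ge0// /L; lra.
  lra.
have mono s t : 0 <= s -> s <= t -> 0 <= t `^ r - s `^ r.
  move=> s0 st; rewrite subr_ge0 ge0_ler_powR ?nnegrE ?(ltW r0)//.
  exact: le_trans st.
exists (e / L); first exact: divr_gt0.
move=> s t /andP[s0 sb] /andP[t0 tb]; rewrite ltr_pdivlMr// mulrC.
have [st|/ltW ts] := leP s t.
  rewrite distrC (distrC (_ `^ _)) !ger0_norm ?subr_ge0//; last first.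
    by rewrite -subr_ge0 mono.
  by apply: le_lt_trans; exact: lip.
rewrite !ger0_norm ?subr_ge0//; last by rewrite -subr_ge0 mono.
by apply: le_lt_trans; exact: lip.
Qed.

Lemma powR_bounded r b t : 1 <= r -> 0 <= t <= b -> `|t `^ r| <= b `^ r.
Proof.
move=> r1 /andP[t0 tb]; rewrite ger0_norm ?powR_ge0// ge0_ler_powR ?nnegrE//.
  exact: le_trans r1.
exact: le_trans tb.
Qed.

(** [|sqrt s - sqrt t|^2 <= |s - t|]. *)
Lemma sqrt_unif_continuous b : unif_continuous_on b (@Num.sqrt R).
Proof.
move=> e e0; exists (e ^+ 2) => [|s t]; first by rewrite exprn_gt0.
move=> /andP[s0 _] /andP[t0 _] st.
rewrite -(@ltr_pXn2r _ 2)// ?nnegrE ?(ltW e0)//; apply: le_lt_trans st.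
wlog ts : s t s0 t0 / t <= s.
  move=> W; have [|/ltW] := leP t s; first exact: W.
  by rewrite distrC (distrC s); exact: W.
rewrite real_normK ?num_real// ger0_norm ?subr_ge0//.
have h : 0 <= Num.sqrt t * (Num.sqrt s - Num.sqrt t).
  by rewrite mulr_ge0 ?sqrtr_ge0// subr_ge0 ler_wsqrtr.
move: (sqr_sqrtr s0) (sqr_sqrtr t0) h; lra.
Qed.

End Powers.
(** * Polynomials of a symmetric operator *)

Section PolynomialCalculus.
Variables (R : realType) (X : Type) (H : rkhs R X) (A : H -> H).
Hypotheses (bA : bounded_op A) (sA : forall u v, rinner (A u) v = rinner u (A v)).
Implicit Types (u v w : H) (p q : {poly R}) (e c t : R).
Let lA := bA.1.

(** Polynomials in [A] with complex coefficients: real polynomials only factor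
    completely over [R[i]]. *)
Definition cpoly_op (q : {poly R[i]}) : H -> H :=
  fun u => \sum_(i < size q) q`_i *: iter i A u.

Lemma cpoly_op_widen n (q : {poly R[i]}) u : (size q <= n)%N ->
  cpoly_op q u = \sum_(i < n) q`_i *: iter i A u.
Proof.
move=> qn; rewrite /cpoly_op (big_ord_widen n (fun i => q`_i *: iter i A u))//.
rewrite big_mkcond/=; apply: eq_bigr => i _; case: ltnP => // iq.
by rewrite nth_default// scale0r.
Qed.

Lemma cpoly_opD (p q : {poly R[i]}) u :
  cpoly_op (p + q) u = cpoly_op p u + cpoly_op q u.
Proof.
pose n := maxn (size p) (size q).
rewrite (@cpoly_op_widen n p) ?leq_maxl// (@cpoly_op_widen n q) ?leq_maxr//.
rewrite (@cpoly_op_widen n) ?size_polyD// -big_split/=.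
by apply: eq_bigr => i _; rewrite coefD scalerDl.
Qed.

Lemma cpoly_opZ (c0 : R[i]) (q : {poly R[i]}) u :
  cpoly_op (c0 *: q) u = c0 *: cpoly_op q u.
Proof.
rewrite (@cpoly_op_widen (size q)) ?size_scale_leq// scaler_sumr.
by apply: eq_bigr => i _; rewrite coefZ scalerA.
Qed.

Lemma cpoly_opC (c0 : R[i]) u : cpoly_op c0%:P u = c0 *: u.
Proof.
by rewrite (@cpoly_op_widen 1) ?size_polyC_leq1// big_ord1 coefC.
Qed.

Lemma cpoly_opMX (q : {poly R[i]}) u : cpoly_op (q * 'X) u = cpoly_op q (A u).
Proof.
rewrite (@cpoly_op_widen (size q).+1); last first.
  by rewrite (leq_trans (size_polyMleq _ _))// size_polyX addn2.
rewrite big_ord_recl coefMX eqxx scale0r add0r.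
by apply: eq_bigr => i _; rewrite coefMX /= -iterSr.
Qed.

Lemma cpoly_op_rec (q : {poly R[i]}) (c0 : R[i]) :
  cpoly_op (q * 'X + c0%:P) = (cpoly_op q \o A) + c0 *: id.
Proof. by apply/funext => u; rewrite cpoly_opD cpoly_opMX cpoly_opC !fctE. Qed.

Lemma cpoly_op0 : cpoly_op 0 = (0 : R[i]) *: id.
Proof. by apply/funext => u; rewrite -polyC0 cpoly_opC. Qed.

Lemma cpoly_op_bounded (q : {poly R[i]}) : bounded_op (cpoly_op q).
Proof.
elim/poly_ind: q => [|q c0 IH].
  by rewrite cpoly_op0; apply: bounded_opZ; exact: bounded_op_id.
rewrite cpoly_op_rec; apply: bounded_opD; first exact: bounded_op_comp.
by apply: bounded_opZ; exact: bounded_op_id.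
Qed.

Lemma cpoly_opA (q : {poly R[i]}) u : cpoly_op q (A u) = A (cpoly_op q u).
Proof.
elim/poly_ind: q u => [|q c0 IH] u.
  by rewrite cpoly_op0 !fctE !scale0r (lin0 lA).
by rewrite cpoly_op_rec !fctE IH/= (linDE lA) (linZE lA).
Qed.

Lemma cpoly_opM (p q : {poly R[i]}) u : cpoly_op (p * q) u = cpoly_op p (cpoly_op q u).
Proof.
elim/poly_ind: p u => [|p c0 IH] u.
  by rewrite mul0r cpoly_op0 !fctE !scale0r.
have -> : (p * 'X + c0%:P) * q = p * q * 'X + c0 *: q.
  by rewrite mulrDl mul_polyC mulrAC.
by rewrite cpoly_opD cpoly_opMX cpoly_opZ IH cpoly_op_rec !fctE/= cpoly_opA.
Qed.

Lemma poly_opE p : poly_op p A = cpoly_op (map_poly (real_complex R) p).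
Proof.
apply/funext => u; rewrite /poly_op /cpoly_op size_map_poly.
by apply: eq_bigr => i _; rewrite coef_map.
Qed.

Lemma poly_op_bounded p : bounded_op (poly_op p A).
Proof. by rewrite poly_opE; exact: cpoly_op_bounded. Qed.

Lemma poly_opD p q u : poly_op (p + q) A u = poly_op p A u + poly_op q A u.
Proof. by rewrite !poly_opE rmorphD cpoly_opD. Qed.

Lemma poly_opM p q u : poly_op (p * q) A u = poly_op p A (poly_op q A u).
Proof. by rewrite !poly_opE rmorphM cpoly_opM. Qed.

Lemma poly_opC c u : poly_op c%:P A u = c%:C *: u.
Proof. by rewrite poly_opE map_polyC cpoly_opC. Qed.

Lemma poly_opX u : poly_op 'X A u = A u.
Proof.
rewrite poly_opE map_polyX -[X in cpoly_op X]mul1r -polyC1.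
by rewrite cpoly_opMX cpoly_opC scale1r.
Qed.

Lemma poly_opN p u : poly_op (- p) A u = - poly_op p A u.
Proof.
rewrite -mulN1r -(polyCN 1) poly_opM poly_opC rmorphN rmorph1 scaleN1r.
by [].
Qed.

Lemma poly_opB p q u : poly_op (p - q) A u = poly_op p A u - poly_op q A u.
Proof. by rewrite poly_opD poly_opN. Qed.

Lemma poly_op_sym p u v : rinner (poly_op p A u) v = rinner u (poly_op p A v).
Proof.
elim/poly_ind: p u v => [|p c IH] u v.
  by rewrite -polyC0 !poly_opC rinnerZl rinnerZr.
rewrite !poly_opD !poly_opM !poly_opX !poly_opC rinnerDl rinnerDr rinnerZl rinnerZr.
by rewrite IH sA !poly_opE cpoly_opA.
Qed.

Definition bounded_below (T : H -> H) :=
  exists2 d : R, 0 < d & forall u, d * rnorm u <= rnorm (T u).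

Lemma bounded_below_comp (S T : H -> H) :
  bounded_below S -> bounded_below T -> bounded_below (S \o T).
Proof.
move=> [d d0 Sd] [d' d'0 Td]; exists (d * d'); first exact: mulr_gt0.
move=> u; rewrite -mulrA (le_trans _ (Sd _))// ler_wpM2l//; exact: ltW.
Qed.

Lemma rinner_iC u v : rinner ('i%C *: u) v = - rinner u ('i%C *: v).
Proof.
rewrite /rinner linearZl_LR linearZr_LR/= -ReN; congr complex.Re.
rewrite -mulNr; congr (_ * _).
by apply/eqP; rewrite eq_complex/= oppr0 opprK !eqxx.
Qed.

Lemma rnorm_iC u : rnorm ('i%C *: u) = rnorm u.
Proof. by rewrite rnormZ normc_def/= expr0n expr1n add0r sqrtr1 mul1r. Qed.

(** [<A u, i u>] has real part zero, and [<z u, i u>] has real part [Im z |u|^2]. *)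
Lemma nonreal_bounded_below (z : R[i]) : complex.Im z != 0 ->
  bounded_below (fun u => A u - z *: u).
Proof.
case: z => a b /= b0; exists `|b| => [|u]; first by rewrite normr_gt0.
have orth w v : rinner w ('i%C *: v) = - rinner v ('i%C *: w).
  by rewrite rinnerC rinner_iC.
have uiu : rinner u ('i%C *: u) = 0 by have := orth u u; lra.
have Auiu : rinner (A u) ('i%C *: u) = 0.
  by have := orth (A u) u; rewrite -(linZE lA) -sA; lra.
have zE : (a +i* b) *: u = a%:C *: u + b%:C *: ('i%C *: u).
  rewrite scalerA -scalerDl; congr (_ *: _).
  by apply/eqP; rewrite eq_complex/= !mul0r !mulr0 mulr1 subr0 !addr0 add0r !eqxx.
have [->|] := eqVneq u 0; first by rewrite rnorm0 mulr0 rnorm_ge0.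
rewrite -rnorm_gt0 => u0; rewrite -(ler_pM2r u0).
rewrite -{3}rnorm_iC (le_trans _ (normr_rinner_le _ _))//.
rewrite rinnerBl Auiu zE rinnerDl !rinnerZl uiu rinnerxx rnorm_iC.
by rewrite mulr0 !add0r normrN normrM normrX (ger0_norm (rnorm_ge0 u)) expr2 mulrA.
Qed.

(** A bounded left inverse [S] of [A - z] gives [|u| <= |S| |A u - z u|]. *)
Lemma resolvent_bounded_below (z : R[i]) : ~ spectrum A z ->
  bounded_below (fun u => A u - z *: u).
Proof.
move=> /contrapT[S [/bounded_opP[lS [C C0 SC]] _ SA]].
exists (C + 1)^-1 => [|u]; first by rewrite invr_gt0 ltr_wpDl.
rewrite mulrC ler_pdivrMr ?ltr_wpDl// mulrC -{1}[u](congr1 (@^~ u) SA)/=.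
by rewrite (le_trans (SC _))// ler_wpM2r ?rnorm_ge0// lerDl.
Qed.

(** Factor [q] over [R[i]]: a product of operators bounded below is bounded
    below. *)
Lemma cpoly_op_bounded_below (q : {poly R[i]}) : q != 0 ->
  (forall z, root q z -> bounded_below (fun u => A u - z *: u)) ->
  bounded_below (cpoly_op q).
Proof.
move=> q0; have [r qE] := closed_field_poly_normal q.
have lq : lead_coef q != 0 by rewrite lead_coef_eq0.
rewrite {1}qE => Hr.
have {}Hr z : z \in r -> bounded_below (fun u => A u - z *: u).
  by move=> zr; apply: Hr; rewrite rootZ// root_prod_XsubC.
have bprod : bounded_below (cpoly_op (\prod_(z <- r) ('X - z%:P))).
  elim: r Hr {qE} => [|z r IH] Hr.
    exists 1 => // u; rewrite big_nil -polyC1 cpoly_opC scale1r mul1r//.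
  have -> : cpoly_op (\prod_(x <- z :: r) ('X - x%:P)) =
      (fun u => A u - z *: u) \o cpoly_op (\prod_(x <- r) ('X - x%:P)).
    apply/funext => u; rewrite big_cons cpoly_opM/= -scaleNr -polyCN.
    rewrite cpoly_opD -[X in cpoly_op X _]mul1r -polyC1 cpoly_opMX.
    by rewrite !cpoly_opC scale1r.
  apply: bounded_below_comp; first by apply: Hr; rewrite inE eqxx.
  by apply: IH => x xr; apply: Hr; rewrite inE xr orbT.
have [d d0 dP] := bprod; exists (complex.Re `|lead_coef q| * d).
  by rewrite mulr_gt0// -ltcR RRe_real ?normr_real// normr_gt0.
move=> u; rewrite qE cpoly_opZ rnormZ -qE -mulrA ler_wpM2l//.
exact: Re_norm_ge0.
Qed.

(** A nonnegative bounded symmetric operator [D] that is bounded below is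
    coercive, since [|D u|^2 <= |D| <D u, u>]. *)
Lemma nonneg_bounded_below_coercive (D : H -> H) : bounded_op D ->
  (forall u v, rinner (D u) v = rinner u (D v)) -> (forall u, 0 <= rinner (D u) u) ->
  bounded_below D -> exists2 d, 0 < d & forall u, d * rnorm u ^+ 2 <= rinner (D u) u.
Proof.
move=> /bounded_opP[lD [K K0 DK]] sD D0 [d d0 Dd].
have K1 : 0 < K + 1 by rewrite ltr_wpDl.
exists (d ^+ 2 / (K + 1)) => [|u]; first by rewrite divr_gt0 ?exprn_gt0.
pose s := (K + 1)^-1.
have s0 : 0 < s by rewrite invr_gt0.
(* With this [s], nonnegativity of the form at [u - s D u] gives
   [s |D u|^2 <= <D u, u>]. *)
have := D0 (u - s%:C *: D u).
rewrite (linBE lD) (linZE lD) rinnerBl !rinnerBr !rinnerZl !rinnerZr rinnerxx.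
rewrite (sD (D u) u) rinnerxx => h.
have h1 : rinner (D (D u)) (D u) <= (K + 1) * rnorm (D u) ^+ 2.
  rewrite (le_trans (rinner_le _ _))// expr2 mulrA ler_wpM2r ?rnorm_ge0//.
  by rewrite (le_trans (DK _))// ler_wpM2r ?rnorm_ge0// lerDl.
have h2 : s * rinner (D (D u)) (D u) <= rnorm (D u) ^+ 2.
  by rewrite /s mulrC ler_pdivrMr// mulrC.
have h3 : s * (s * rinner (D (D u)) (D u)) <= s * rnorm (D u) ^+ 2 by rewrite ler_pM2l.
have h4 : s * (d * rnorm u) ^+ 2 <= s * rnorm (D u) ^+ 2.
  by rewrite ler_pM2l// ler_pXn2r ?nnegrE ?mulr_ge0 ?rnorm_ge0 ?(ltW d0).
rewrite -/s; lra.
Qed.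

(** With [m] the infimum of [<p(A) u, u>] over the unit sphere, [p(A) - m] is not
    bounded below, hence neither is some [A - z] with [p(z) = m]; such a [z] is
    real and lies in the spectrum. *)
Lemma poly_op_inf_spectrum p u0 : (1 < size p)%N -> u0 != 0 ->
  exists2 t, spectrum A t%:C &
    forall u, p.[t] * rnorm u ^+ 2 <= rinner (poly_op p A u) u.
Proof.
move=> p1 u00.
have /bounded_opP[lP [K K0 PK]] := poly_op_bounded p.
pose V := [set rinner (poly_op p A u) u | u in [set u | rnorm u = 1]].
have unit u : u != 0 -> rnorm ((rnorm u)^-1%:C *: u) = 1.
  rewrite -rnorm_gt0 => uu; rewrite rnormZr ger0_norm ?invr_ge0 ?rnorm_ge0//.
  by rewrite mulVf// gt_eqF.
have Vunit u : rinner (poly_op p A ((rnorm u)^-1%:C *: u)) ((rnorm u)^-1%:C *: u) =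
    rinner (poly_op p A u) u / rnorm u ^+ 2.
  by rewrite (linZE lP) rinnerZl rinnerZr -exprVn; ring.
have hV : has_inf V.
  split; first by eexists; exists ((rnorm u0)^-1%:C *: u0); [exact: unit|].
  exists (- K) => _ [u u1 <-].
  have := normr_rinner_le (poly_op p A u) u; rewrite u1 mulr1 ler_norml => /andP[+ _].
  by apply: le_trans; rewrite lerN2 -[K]mulr1 -u1 PK.
pose m := inf V.
have mle u : m * rnorm u ^+ 2 <= rinner (poly_op p A u) u.
  have [->|uu] := eqVneq u 0.
    by rewrite rnorm0 expr0n mulr0 rinner0r.
  have uu' := uu; rewrite -rnorm_gt0 in uu'.
  rewrite -ler_pdivlMr ?exprn_gt0// -Vunit; apply: ge_inf; first by case: hV.
  by exists ((rnorm u)^-1%:C *: u) => //; exact: unit.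
suff [t At pt] : exists2 t, spectrum A t%:C & p.[t] = m by exists t; rewrite // pt.
apply: contrapT => mP.
pose D := poly_op (p - m%:P) A.
have DE u : D u = poly_op p A u - m%:C *: u by rewrite /D poly_opB poly_opC.
have D0 u : 0 <= rinner (D u) u.
  by rewrite DE rinnerBl rinnerZl rinnerxx subr_ge0.
have bbD : bounded_below D.
  rewrite /D poly_opE; apply: cpoly_op_bounded_below.
    rewrite map_poly_eq0 subr_eq0; apply: contraTneq p1 => ->.
    by rewrite -leqNgt size_polyC_leq1.
  move=> z; have [z0|] := eqVneq (complex.Im z) 0; last first.
    by move=> /nonreal_bounded_below.
  have -> : z = (complex.Re z)%:C by rewrite {1}[z]complex_eta z0.
  move: (complex.Re z) => t {z z0}.
  rewrite /root horner_map/= -(rmorph0 (real_complex R)) => /eqP/complexI.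
  rewrite hornerD hornerN hornerC => /eqP; rewrite subr_eq0 => /eqP pt.
  by apply: resolvent_bounded_below => At; apply: mP; exists t.
have [d d0 Dd] := nonneg_bounded_below_coercive (poly_op_bounded _)
  (poly_op_sym _) D0 bbD.
have : m + d <= m.
  apply: lb_le_inf; first by case: hV.
  move=> _ [u /= u1 <-]; have := Dd u.
  by rewrite -/D DE rinnerBl rinnerZl rinnerxx u1 expr1n; lra.
by rewrite gerDl leNgt d0.
Qed.

(** The form of a nonconstant [p(A)] is bounded below by a value of [p] on the
    spectrum.  For constant [p] it matters that the spectrum is not empty, which
    is the case of the polynomial ['X]. *)
Lemma poly_op_ge0 p : (forall t, spectrum A t%:C -> 0 <= p.[t]) ->
  forall u, 0 <= rinner (poly_op p A u) u.
Proof.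
move=> p0 u; have [->|u0] := eqVneq u 0; first by rewrite rinner0r.
have [p1|p1] := leqP (size p) 1.
  have X1 : (1 < size ('X : {poly R}))%N by rewrite size_polyX.
  have [t /p0 + _] := poly_op_inf_spectrum X1 u0.
  have [c ->] : exists c, p = c%:P by exists p`_0; exact: size1_polyC.
  rewrite hornerC poly_opC rinnerZl rinnerxx => c0.
  by rewrite mulr_ge0 ?exprn_ge0 ?rnorm_ge0.
have [t /p0 t0 tp] := poly_op_inf_spectrum p1 u0.
by apply: le_trans (tp u); rewrite mulr_ge0 ?exprn_ge0 ?rnorm_ge0.
Qed.

Lemma poly_op_le p q : (forall t, spectrum A t%:C -> p.[t] <= q.[t]) ->
  forall u, rinner (poly_op p A u) u <= rinner (poly_op q A u) u.
Proof.
move=> pq u; rewrite -subr_ge0 -rinnerBl -poly_opB; apply: poly_op_ge0 => t /pq.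
by rewrite hornerD hornerN subr_ge0.
Qed.

Lemma rnorm_poly_op_sqr p u :
  rnorm (poly_op p A u) ^+ 2 = rinner (poly_op (p * p) A u) u.
Proof. by rewrite poly_opM poly_op_sym rinnerxx. Qed.

(** [c^2 - p^2] is nonnegative on the spectrum. *)
Lemma poly_op_norm_le p c : 0 <= c -> (forall t, spectrum A t%:C -> `|p.[t]| <= c) ->
  forall u, rnorm (poly_op p A u) <= c * rnorm u.
Proof.
move=> c0 pc u; rewrite -(@ler_pXn2r _ 2)// ?nnegrE ?mulr_ge0 ?rnorm_ge0//.
rewrite rnorm_poly_op_sqr exprMn -rinnerxx -rinnerZl -poly_opC.
apply: poly_op_le => t /pc pt; rewrite hornerM hornerC -expr2.
by rewrite -(real_normK (num_real p.[t])) ler_pXn2r ?nnegrE.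
Qed.

End PolynomialCalculus.
(** * Continuous functional calculus *)

Section FunctionalCalculus.
Variables (R : realType) (X : Type) (H : rkhs R X) (A : H -> H).
Hypotheses (bA : bounded_op A) (sA : forall u v, rinner (A u) v = rinner u (A v)).
Implicit Types (u v w : H) (p q : {poly R}) (e c t K : R) (f : R -> R) (B : H -> H).

(** One polynomial approximates [f] on the spectrum and [B] in operator norm; the
    properties of [B] below are those of [p(A)], up to an error controlled by
    [e]. *)
Lemma fun_calc_lim f B : is_fun_calc f A B -> forall e, 0 < e ->
  exists p, (forall t, spectrum A t%:C -> `|p.[t] - f t| < e) /\
            (forall u, rnorm (poly_op p A u - B u) <= e * rnorm u).
Proof.
move=> [bB [p [/uniform_realP pf /uniform_ballP pB]]] e e0.
have [N1 N1P] := pf _ e0; have [N2 N2P] := pB _ e0.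
exists (p (maxn N1 N2)); split; first by apply: N1P; exact: leq_maxl.
move=> u; have [->|] := eqVneq u 0.
  by rewrite (lin0 bB.1) (lin0 (poly_op_bounded bA _).1) subrr rnorm0 mulr0.
rewrite -rnorm_gt0 => u0.
have := N2P _ (leq_maxr N1 N2) ((rnorm u)^-1%:C *: u).
rewrite (linZE bB.1) (linZE (poly_op_bounded bA _).1) -scalerBr !rnormZr.
rewrite gtr0_norm ?invr_gt0// mulVf ?gt_eqF// lexx => /(_ isT)/ltW.
by rewrite mulrC ler_pdivrMr.
Qed.

Lemma fun_calc_sym f B : is_fun_calc f A B ->
  forall u v, rinner (B u) v = rinner u (B v).
Proof.
move=> fB u v; apply/eqP; rewrite -subr_eq0 -normr_eq0 eq_le normr_ge0 andbT.
apply/ler_addgt0Pr => e e0; rewrite add0r.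
pose k := 2 * rnorm u * rnorm v + 1.
have k0 : 0 < k by rewrite ltr_wpDl ?mulr_ge0 ?rnorm_ge0.
have [p [_ pB]] := fun_calc_lim fB (divr_gt0 e0 k0).
have -> : rinner (B u) v - rinner u (B v) =
    rinner u (poly_op p A v - B v) - rinner (poly_op p A u - B u) v.
  by rewrite rinnerBl rinnerBr (poly_op_sym bA sA); ring.
rewrite (le_trans (ler_normB _ _))//.
rewrite (le_trans (lerD (normr_rinner_le _ _) (normr_rinner_le _ _)))//.
have h1 := ler_wpM2l (rnorm_ge0 u) (pB v).
have h2 := ler_wpM2r (rnorm_ge0 v) (pB u).
rewrite (le_trans (lerD h1 h2))//.
have -> : rnorm u * (e / k * rnorm v) + e / k * rnorm u * rnorm v =
  e / k * (k - 1) by rewrite /k; ring.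
by rewrite mulrAC ler_pdivrMr// ler_pM2l// gerBl.
Qed.

(** If [q <= f] on the spectrum then [q - e <= p] there for a close approximation
    [p] of [f], and [poly_op_le] applies to these polynomials. *)
Lemma fun_calc_lower f B q : is_fun_calc f A B ->
  (forall t, spectrum A t%:C -> q.[t] <= f t) ->
  forall u, rinner (poly_op q A u) u <= rinner (B u) u.
Proof.
move=> fB qf u; apply/ler_addgt0Pr => e e0.
pose k := 2 * rnorm u ^+ 2 + 1.
have k0 : 0 < k by rewrite ltr_wpDl ?mulr_ge0 ?exprn_ge0 ?rnorm_ge0.
have ek0 := divr_gt0 e0 k0.
have [p [pf pB]] := fun_calc_lim fB ek0.
have h1 : rinner (poly_op (q - (e / k)%:P) A u) u <= rinner (poly_op p A u) u.
  apply: poly_op_le => // t At; rewrite hornerD hornerN hornerC.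
  by have := pf _ At; have := qf _ At; rewrite ltr_norml => ? /andP[? ?]; lra.
have h2 := rinner_le (poly_op p A u - B u) u.
have h3 := ler_wpM2r (rnorm_ge0 u) (pB u).
have h4 : e / k * (2 * rnorm u ^+ 2) <= e.
  by rewrite mulrAC ler_pdivrMr// ler_pM2l// lerDl.
move: h1 h2; rewrite poly_opB// poly_opC !rinnerBl rinnerZl rinnerxx; lra.
Qed.

(** For [p] close to [f], [|p(A) u|^2 = <p^2(A) u, u>] is close to [<q(A) u, u>]. *)
Lemma fun_calc_sqr f B q K : is_fun_calc f A B ->
  (forall t, spectrum A t%:C -> f t ^+ 2 = q.[t] /\ `|f t| <= K) ->
  forall u, rnorm (B u) ^+ 2 = rinner (poly_op q A u) u.
Proof.
move=> fB fK u.
have bB : bounded_op B by case: fB.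
pose U := rnorm u; have U0 : 0 <= U := rnorm_ge0 u.
pose V := rnorm (B u); have V0 : 0 <= V := rnorm_ge0 _.
apply/eqP; rewrite -subr_eq0 -normr_eq0 eq_le normr_ge0 andbT.
apply/ler_addgt0Pr => e e0; rewrite add0r.
pose k := (2 * `|K| + 1) * U ^+ 2 + (2 * V + U) * U + 1.
have k0 : 0 < k.
  by rewrite ltr_wpDl// addr_ge0// mulr_ge0 ?exprn_ge0 ?addr_ge0 ?mulr_ge0.
(* With [d <= 1] and [d k <= e], the errors [h1] and [h3] sum up to at most [e]. *)
pose d := Num.min 1 (e / k).
have d0 : 0 < d by rewrite lt_min ltr01 divr_gt0.
have d1 : d <= 1 by rewrite ge_min lexx.
have dk : d * k <= e by rewrite -ler_pdivlMr// ge_min lexx orbT.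
have [p [pf pB]] := fun_calc_lim fB d0.
have h1 : `|rinner (poly_op (p * p - q) A u) u| <= d * (2 * `|K| + 1) * U ^+ 2.
  rewrite (le_trans (normr_rinner_le _ _))// expr2 mulrA ler_wpM2r//.
  apply: poly_op_norm_le => //.
    by rewrite mulr_ge0 ?(ltW d0)// addr_ge0 ?mulr_ge0.
  move=> t At; have [ft Kt] := fK _ At; have pt := ltW (pf _ At).
  rewrite hornerD hornerN hornerM -ft.
  have -> : p.[t] * p.[t] - f t ^+ 2 =
    (p.[t] - f t) * ((p.[t] - f t) + 2 * f t) by ring.
  rewrite normrM ler_pM// (le_trans (ler_normD _ _))// normrM ger0_norm//.
  by have := le_trans Kt (ler_norm K); lra.
have h2 : `|rnorm (poly_op p A u) - V| <= d * U.
  have a1 := rnormD (poly_op p A u - B u) (B u).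
  have a2 := rnormB (poly_op p A u) (poly_op p A u - B u).
  rewrite subrK in a1; rewrite subKr in a2.
  have := pB u; rewrite -/U => a3; rewrite -/V in a1 a2.
  by rewrite ler_norml; apply/andP; split; lra.
have h3 : `|rnorm (poly_op p A u) ^+ 2 - V ^+ 2| <= d * U * (2 * V + U).
  have -> : rnorm (poly_op p A u) ^+ 2 - V ^+ 2 =
    (rnorm (poly_op p A u) - V) * ((rnorm (poly_op p A u) - V) + 2 * V) by ring.
  rewrite normrM ler_pM// (le_trans (ler_normD _ _))// (ger0_norm (mulr_ge0 _ V0))//.
  have : d * U <= U by rewrite ler_piMl.
  lra.
move: h1 h3; rewrite poly_opB// rinnerBl -(rnorm_poly_op_sqr bA sA) -/V.
rewrite !ler_norml => /andP[? ?] /andP[? ?].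
have -> : e = d * k + (e - d * k) by ring.
rewrite /k in dk *; apply/andP; split; lra.
Qed.

(** Polynomials that converge uniformly on the spectrum form, when applied to
    [A], a Cauchy sequence for the operator norm. *)
Lemma fun_calc_exists f :
  (forall e, 0 < e -> exists p, forall t, spectrum A t%:C -> `|p.[t] - f t| < e) ->
  exists B, is_fun_calc f A B.
Proof.
move=> fp.
have /choice[p pf] n : exists p,
    forall t, spectrum A t%:C -> `|p.[t] - f t| < n.+1%:R^-1.
  by apply: fp; rewrite invr_gt0.
have pC e : 0 < e -> exists N, forall m n, (N <= m)%N -> (N <= n)%N -> forall u,
    rnorm (poly_op (p m) A u - poly_op (p n) A u) <= e * rnorm u.
  move=> e0; have [N NP] := invS_small (divr_gt0 e0 (@ltr0Sn R 1)).
  exists N => m n /NP Nm /NP Nn u; rewrite -poly_opB//.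
  apply: poly_op_norm_le => // [|t At]; first exact: ltW.
  rewrite hornerD hornerN; move: (pf m _ At) (pf n _ At) Nm Nn.
  move: (m.+1%:R^-1) (n.+1%:R^-1) => a b.
  by rewrite ler_norml !ltr_norml => /andP[? ?] /andP[? ?] ? ?; apply/andP; split; lra.
have /choice[B BP] u : exists l, seq_lim (fun n => poly_op (p n) A u) l.
  apply: cauchy_seq_lim => e e0.
  have u0 : 0 < rnorm u + 1 by rewrite ltr_wpDl ?rnorm_ge0.
  have [N NP] := pC _ (divr_gt0 e0 u0).
  exists N => m n Nm Nn; rewrite (le_lt_trans (NP _ _ Nm Nn u))//.
  by rewrite mulrAC ltr_pdivrMr// ltr_pM2l// ltrDl.
have pB e : 0 < e -> exists N, forall n, (N <= n)%N -> forall u,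
    rnorm (poly_op (p n) A u - B u) <= e * rnorm u.
  move=> e0; have [N NP] := pC _ e0; exists N => n Nn u.
  apply/ler_addgt0Pl => e' e'0; have [N' N'P] := BP u _ e'0.
  rewrite (le_trans (rdistD (poly_op (p (maxn N N')) A u) _ _))// addrC lerD//.
    by rewrite ltW// N'P// leq_maxr.
  by rewrite NP// leq_maxl.
exists B; split; last first.
  exists p; split; [apply/uniform_realP => e e0|apply/uniform_ballP => e e0].
    have [N NP] := invS_small e0; exists N => n /NP Nn t At.
    exact: lt_trans (pf n t At) Nn.
  have [N NP] := pB _ (divr_gt0 e0 (@ltr0Sn R 1)); exists N => n Nn u u1.
  rewrite (le_lt_trans (NP n Nn u))//.
  have : e / 2 * rnorm u <= e / 2 by rewrite ler_piMr// ltW// divr_gt0.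
  lra.
have uniq u l : (forall e, 0 < e -> rnorm (B u - l) <= e) -> B u = l.
  move=> Bl; apply/eqP; rewrite -subr_eq0; apply/eqP/rnorm_eq0/eqP.
  rewrite eq_le rnorm_ge0 andbT; apply/ler_addgt0Pr => e e0.
  by rewrite add0r Bl.
apply/bounded_opP; split.
  move=> a u v; apply: uniq => e e0.
  pose k := rnorm (a *: u + v) + complex.Re `|a| * rnorm u + rnorm v + 1.
  have a0 := Re_norm_ge0 a.
  have k0 : 0 < k by rewrite ltr_wpDl// !addr_ge0 ?mulr_ge0 ?rnorm_ge0.
  have [N NP] := pB _ (divr_gt0 e0 k0).
  have {}NP := NP N (leqnn N); set P := poly_op (p N) A in NP.
  have PE : P (a *: u + v) = a *: P u + P v := (poly_op_bounded bA _).1 a u v.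
  have -> : B (a *: u + v) - (a *: B u + B v) =
      (a *: (P u - B u) + (P v - B v)) - (P (a *: u + v) - B (a *: u + v)).
    rewrite PE scalerBr addrACA -opprD opprB [RHS]addrC addrA subrK.
    by [].
  rewrite (le_trans (rnormB _ _))// (le_trans (lerD (rnormD _ _) (lexx _)))//.
  rewrite rnormZ.
  have := ler_wpM2l a0 (NP u); have := NP v; have := NP (a *: u + v).
  have : e / k * k = e by rewrite divfK// gt_eqF.
  by rewrite {2}/k; have := divr_gt0 e0 k0; lra.
have [N NP] := pB 1 ltr01; have {}NP := NP N (leqnn N).
have /bounded_opP[_ [C C0 PC]] := poly_op_bounded bA (p N).
exists (C + 1) => [|u]; first exact: addr_ge0.
have := rnormB (poly_op (p N) A u) (poly_op (p N) A u - B u); rewrite subKr.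
by move: (PC u) (NP u); lra.
Qed.

(** [A - t] is coercive for [t < 0], and so is [t - A] for [t > b]. *)
Lemma spectrum_nonneg b t : (forall u, 0 <= rinner (A u) u) ->
  (forall u, rnorm (A u) <= b * rnorm u) -> spectrum A t%:C -> 0 <= t <= b.
Proof.
move=> A0 Ab At; apply: contrapT => tb; apply: At.
have bT (c0 : R[i]) : bounded_op (A - c0 *: id).
  rewrite -scaleNr; apply: bounded_opD => //; apply: bounded_opZ.
  exact: bounded_op_id.
have TE u : (A - t%:C *: id) u = A u - t%:C *: u by [].
have Aub u : rinner (A u) u <= b * rnorm u ^+ 2.
  by rewrite (le_trans (rinner_le _ _))// expr2 mulrA ler_wpM2r ?rnorm_ge0.
have [t0|t0] := ltP t 0.
  apply: (@coercive_invertible _ _ _ _ (- t)) => //; first by rewrite oppr_gt0.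
  by move=> u; rewrite TE rinnerBl rinnerZl rinnerxx; have := A0 u; lra.
have {tb}tb : b < t by rewrite ltNge; apply/negP => tb'; apply: tb; rewrite t0.
have [||u|S [bS TS ST]] := @coercive_invertible _ _ _ (-1 *: (A - t%:C *: id)) (t - b).
- exact: bounded_opZ.
- by rewrite subr_gt0.
- have -> : (-1 *: (A - t%:C *: id)) u = t%:C *: u - A u.
    by rewrite !fctE/= scaleN1r opprB.
  rewrite rinnerBl rinnerZl rinnerxx.
  by have := Aub u; lra.
exists (-1 *: S); split; first exact: bounded_opZ.
  apply/funext => u; rewrite -[RHS](congr1 (@^~ u) TS).
  exact: (linZE (bT t%:C).1).
apply/funext => u; rewrite -[RHS](congr1 (@^~ u) ST).
exact: esym (linZE bS.1 _ _).
Qed.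

End FunctionalCalculus.
(** * Powers and absolute values *)

Section PowersOfPositiveOperators.
Variables (R : realType) (X : Type) (H : rkhs R X).
Implicit Types (u v w : H) (A B M : H -> H).

(** Symmetry is stated for the real inner product, which for a complex-linear [A] is
    self-adjointness. *)
Record positive_op A : Prop := PositiveOp {
  positive_bounded : bounded_op A ;
  positive_sym : forall u v, rinner (A u) v = rinner u (A v) ;
  positive_ge0 : forall u, 0 <= rinner (A u) u }.

Lemma fun_calcP (f : R -> R) A :
  (exists B, is_fun_calc f A B) -> is_fun_calc f A (fun_calc f A).
Proof. by move=> [B fB]; rewrite /fun_calc; case: xgetP => // /(_ B)/(_ fB). Qed.

Lemma positive_spectrum A : positive_op A ->
  exists2 b : R, 0 < b & forall t, spectrum A t%:C -> 0 <= t <= b.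
Proof.
move=> [bA sA A0]; have /bounded_opP[lA [C C0 AC]] := bA.
exists (C + 1) => [|t]; first by rewrite ltr_wpDl.
apply: spectrum_nonneg => // u.
by rewrite (le_trans (AC u))// ler_wpM2r ?rnorm_ge0// lerDl.
Qed.

Lemma fun_calc_continuous (f : R -> R) A : positive_op A ->
  (forall b, 0 < b -> unif_continuous_on b f) ->
  (forall b, 0 < b -> exists K, forall t, 0 <= t <= b -> `|f t| <= K) ->
  is_fun_calc f A (fun_calc f A).
Proof.
move=> pA fc fK; apply: fun_calcP; have [b b0 Ab] := positive_spectrum pA.
have [K Kf] := fK b b0.
apply: fun_calc_exists; [exact: positive_bounded|exact: positive_sym|].
move=> e e0; have [p pf] := weierstrass b0 Kf (fc b b0) e0.
by exists p => t /Ab; exact: pf.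
Qed.

Lemma op_powP A (s : R) : positive_op A -> 1 <= s ->
  is_fun_calc (fun t => t `^ s) A (op_pow A s).
Proof.
move=> pA s1; apply: fun_calc_continuous => // b b0.
  exact: powR_unif_continuous.
by exists (b `^ s) => t; exact: powR_bounded.
Qed.

Lemma fun_calc_positive (f : R -> R) A B : positive_op A -> is_fun_calc f A B ->
  (forall t, 0 <= t -> 0 <= f t) -> positive_op B.
Proof.
move=> pA fB f0; have [bA sA A0] := pA; have [b b0 Ab] := positive_spectrum pA.
split; [by case: fB|exact: fun_calc_sym fB|move=> u].
have := fun_calc_lower bA sA fB (q := 0) _ u.
rewrite -polyC0 poly_opC// scale0r rinner0l; apply => t /Ab/andP[t0 _].
by rewrite hornerC f0.
Qed.

Lemma op_pow_positive A (s : R) : positive_op A -> 1 <= s -> positive_op (op_pow A s).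
Proof.
move=> pA s1; apply: fun_calc_positive pA (op_powP pA s1) _ => t _.
exact: powR_ge0.
Qed.

Lemma adjoint_comp_positive M : bounded_op M -> positive_op (adjoint M \o M).
Proof.
move=> bM; have bA := adjoint_bounded bM; split; first exact: bounded_op_comp.
- move=> u v /=; rewrite rinnerC -rinner_adjointE// rinnerC.
  by rewrite -rinner_adjointE.
- by move=> u /=; rewrite rinnerC -rinner_adjointE// rinnerxx exprn_ge0// rnorm_ge0.
Qed.

Lemma op_absP M : bounded_op M ->
  is_fun_calc Num.sqrt (adjoint M \o M) (op_abs M).
Proof.
move=> bM; apply: fun_calc_continuous; first exact: adjoint_comp_positive.
  by move=> b _; exact: sqrt_unif_continuous.
move=> b b0; exists (Num.sqrt b) => t /andP[t0 tb].
by rewrite ger0_norm ?sqrtr_ge0// ler_wsqrtr.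
Qed.

Lemma op_abs_positive M : bounded_op M -> positive_op (op_abs M).
Proof.
move=> bM; apply: fun_calc_positive (op_absP bM) _; first exact: adjoint_comp_positive.
by move=> t _; exact: sqrtr_ge0.
Qed.

(** [sqrt t ^ 2 = t] on the spectrum of the nonnegative operator [M^* M]. *)
Lemma rnorm_op_abs M u : bounded_op M -> rnorm (op_abs M u) = rnorm (M u).
Proof.
move=> bM; have pA := adjoint_comp_positive bM; have [bA sA _] := pA.
have [b b0 Ab] := positive_spectrum pA.
apply/eqP; rewrite -(@eqrXn2 _ 2)// ?rnorm_ge0//; apply/eqP.
rewrite (@fun_calc_sqr _ _ _ _ bA sA _ _ 'X (Num.sqrt b) (op_absP bM)).
  by rewrite poly_opX// rinnerC /= -rinner_adjointE// rinnerxx.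
move=> t /Ab/andP[t0 tb]; rewrite hornerX sqr_sqrtr//; split=> //.
by rewrite ger0_norm ?sqrtr_ge0// ler_wsqrtr.
Qed.

(** McCarthy's inequality, with a polynomial [g] of the operator: the tangent to
    the power function at the mean [<g(A) u, u>] lies below its graph. *)
Lemma mccarthy A B (f : R -> R) (g : {poly R}) (r : R) u : positive_op A -> 1 <= r ->
  is_fun_calc f A B ->
  (forall t, 0 <= t -> 0 <= g.[t] /\ f t = g.[t] `^ r) -> rnorm u = 1 ->
  rinner (poly_op g A u) u `^ r <= rinner (B u) u.
Proof.
move=> pA r1 fB fg u1; have [bA sA A0] := pA; have [b b0 Ab] := positive_spectrum pA.
set c := rinner _ _.
have [c0|c0] := ltP 0 c.
  pose q := (c `^ r)%:P + (r * (c `^ r / c))%:P * (g - c%:P).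
  have <- : rinner (poly_op q A u) u = c `^ r.
    rewrite /q poly_opD// poly_opM// poly_opB// !poly_opC// rinnerDl !rinnerZl.
    by rewrite rinnerBl rinnerZl rinnerxx u1 -/c; ring.
  apply: (fun_calc_lower bA sA fB) => t /Ab/andP[/fg[g0 ->] _].
  by rewrite /q hornerD hornerM hornerD hornerN !hornerC powR_tangent.
have -> : c = 0.
  apply/eqP; rewrite eq_le c0/= /c poly_op_ge0// => t /Ab/andP[/fg[]//].
rewrite powR0 ?gt_eqF ?(lt_le_trans ltr01)//.
apply: (positive_ge0 (fun_calc_positive pA fB _)) => t /fg[_ ->].
exact: powR_ge0.
Qed.

(** Powers of [|M|] compare with [|M|^2], whose quadratic form is [|M u|^2]. *)
Lemma op_pow_abs_ge M (r : R) u : bounded_op M -> 1 <= r -> rnorm u = 1 ->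
  (rnorm (M u) ^+ 2) `^ r <= rinner (op_pow (op_abs M) (2 * r) u) u.
Proof.
move=> bM r1 u1; have pA := op_abs_positive bM; have [bA sA _] := pA.
rewrite -rnorm_op_abs// -rinnerxx -sA.
have r2 : 1 <= 2 * r by lra.
have := @mccarthy _ _ _ ('X * 'X) _ _ pA r1 (op_powP pA r2) _ u1.
rewrite poly_opM// !poly_opX//; apply => t t0; rewrite hornerM hornerX -expr2.
by rewrite exprn_ge0// powRrM (powR_mulrn 2).
Qed.

Lemma projection_positive A : bounded_op A -> (forall u, A (A u) = A u) ->
  (forall u v, rinner (A u) v = rinner u (A v)) -> positive_op A.
Proof.
move=> bA AA sA; split=> // u.
by rewrite -AA sA rinnerxx exprn_ge0// rnorm_ge0.
Qed.

Lemma op_pow_projection_ge A (r : R) u : bounded_op A -> (forall u, A (A u) = A u) ->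
  (forall u v, rinner (A u) v = rinner u (A v)) -> 1 <= r -> rnorm u = 1 ->
  (rnorm (A u) ^+ 2) `^ r <= rinner (op_pow A r u) u.
Proof.
move=> bA AA sA r1 u1; have pA := projection_positive bA AA sA.
rewrite -rinnerxx -sA AA -{1}(poly_opX A u).
by apply: (mccarthy pA r1 (op_powP pA r1)) => // t t0; rewrite hornerX.
Qed.

End PowersOfPositiveOperators.

(** * Berezin numbers *)

Section BerezinNumber.
Variables (R : realType) (X : Type) (H : rkhs R X).
Implicit Types (u v w : H) (A B T : H -> H) (x : X).

Lemma rnorm_nkernel x : rkernel H x != 0 -> rnorm (nkernel H x) = 1.
Proof.
rewrite -rnorm_gt0 => k0; rewrite /nkernel normE -fmorphV rnormZr.
by rewrite ger0_norm ?invr_ge0 ?rnorm_ge0// mulVf// gt_eqF.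
Qed.

(** Boundedness of [T] makes the supremum that defines [ber T] an upper bound. *)
Lemma ber_ge T x : bounded_op T -> rkernel H x != 0 ->
  complex.Re `|'[T (nkernel H x), nkernel H x]| <= ber T.
Proof.
move=> /bounded_opP[lT [C C0 TC]] kx.
apply: ub_le_sup; last by exists x.
exists C => _ [y ky <-]; rewrite (le_trans (norm_inner_le _ _))//.
by rewrite (rnorm_nkernel ky) mulr1 (le_trans (TC _))// rnorm_nkernel// mulr1.
Qed.

Lemma inner_sym_real A u : linear A ->
  (forall u v, rinner (A u) v = rinner u (A v)) -> '[A u, u] = (rinner (A u) u)%:C.
Proof.
move=> lA sA; rewrite innerE; congr (_ +i* _).
have := sA ('i%C *: u) u; rewrite (linZE lA) rinner_iC rinnerC.
lra.
Qed.

(** The quadratic forms of [A] and [B] are real, so they are the real and imaginary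
    parts of that of [A + i B]. *)
Lemma ber_sqr_ge A B x : positive_op A -> positive_op B -> rkernel H x != 0 ->
  let u := nkernel H x in
  rinner (A u) u ^+ 2 + rinner (B u) u ^+ 2 <= ber (A + 'i%C *: B) ^+ 2.
Proof.
move=> [bA sA _] [bB sB _] kx; cbv zeta; set u := nkernel H x.
have bT := bounded_opD bA (bounded_opZ 'i%C bB).
have h := ber_ge bT kx.
have E : (complex.Re `|'[(A + 'i%C *: B) u, u]|) ^+ 2 =
    rinner (A u) u ^+ 2 + rinner (B u) u ^+ 2.
  have -> : '[(A + 'i%C *: B) u, u] = rinner (A u) u +i* rinner (B u) u.
    rewrite !fctE linearDl linearZl_LR/= !inner_sym_real//; [|exact: bB.1|exact: bA.1].
    by apply/eqP; rewrite eq_complex/= !mul0r mulr0 !mul1r subrr !addr0 !add0r !eqxx.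
  by rewrite normc_def/= sqr_sqrtr// addr_ge0// sqr_ge0.
have n0 := Re_norm_ge0 '[(A + 'i%C *: B) u, u].
by rewrite -E ler_pXn2r ?nnegrE// (le_trans n0 h).
Qed.

Lemma positive_opD A B : positive_op A -> positive_op B -> positive_op (A + B).
Proof.
move=> [bA sA A0] [bB sB B0]; split; first exact: bounded_opD.
  by move=> u v; rewrite !fctE rinnerDl rinnerDr sA sB.
by move=> u; rewrite fctE rinnerDl addr_ge0.
Qed.

End BerezinNumber.

Lemma sup_powR_le (R : realType) (S : set R) (s c : R) : 0 < s -> 0 <= c ->
  (forall z, S z -> 0 <= z /\ z `^ s <= c) -> sup S `^ s <= c.
Proof.
move=> s0 c0 Sc.
have [->|/set0P[z0 Sz0]] := eqVneq S set0.
  by rewrite sup0 powR0// gt_eqF.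
have Sub z : S z -> z <= c `^ s^-1.
  move=> /Sc[z_ge0 zc]; rewrite -[z](powRr1 z_ge0) -(divff (lt0r_neq0 s0)) powRrM.
  by rewrite ge0_ler_powR ?invr_ge0 ?(ltW s0)// nnegrE powR_ge0.
have supc : sup S <= c `^ s^-1 by apply: ge_sup => //; exists z0.
have sup_ge0 : 0 <= sup S.
  by apply: le_trans (Sc _ Sz0).1 _; apply: ub_le_sup => //; exists (c `^ s^-1).
have := @ge0_ler_powR _ s (ltW s0) _ _ _ _ supc.
rewrite !nnegrE powR_ge0 sup_ge0 -powRrM mulVf ?gt_eqF// powRr1//.
by apply.
Qed.

(** The scalar inequality: [((x + y) / 2)^r <= (x^r + y^r) / 2] by convexity, and
    then [(X + Y)^2 <= (A + B) (P + Q)] for [X^2 <= A P] and [Y^2 <= B Q]. *)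
Lemma scalar_bound (R : realType) (r a p b q A P B Q : R) : 1 <= r ->
  0 <= a -> 0 <= p -> 0 <= b -> 0 <= q ->
  (a ^+ 2) `^ r <= A -> (p ^+ 2) `^ r <= P -> (b ^+ 2) `^ r <= B ->
  (q ^+ 2) `^ r <= Q ->
  (a * p + b * q) `^ (2 * r) <=
    2 `^ (2 * r - 3) * ((A ^+ 2 + Q ^+ 2) + (B ^+ 2 + P ^+ 2)) +
    2 `^ (2 * r - 4) * ((A + Q) ^+ 2 + (B + P) ^+ 2).
Proof.
move=> r1 a0 p0 b0 q0 aA pP bB qQ.
pose x := a * p; pose y := b * q.
have x0 : 0 <= x by rewrite mulr_ge0.
have y0 : 0 <= y by rewrite mulr_ge0.
have sqr_pow z : 0 <= z -> (z ^+ 2) `^ r = (z `^ r) ^+ 2.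
  by move=> z0; rewrite -(powR_mulrn 2 z0) powRAC powR_mulrn// powR_ge0.
have XAP : (x `^ r) ^+ 2 <= A * P.
  by rewrite -sqr_pow// exprMn powRM ?sqr_ge0// ler_pM ?powR_ge0.
have YBQ : (y `^ r) ^+ 2 <= B * Q.
  by rewrite -sqr_pow// exprMn powRM ?sqr_ge0// ler_pM ?powR_ge0.
have A0 : 0 <= A := le_trans (powR_ge0 _ _) aA.
have P0 : 0 <= P := le_trans (powR_ge0 _ _) pP.
have B0 : 0 <= B := le_trans (powR_ge0 _ _) bB.
have Q0 : 0 <= Q := le_trans (powR_ge0 _ _) qQ.
have XYle : 2 * (x `^ r * y `^ r) <= A * Q + B * P.
  rewrite -(@ler_pXn2r _ 2)// ?nnegrE ?addr_ge0 ?mulr_ge0 ?powR_ge0//.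
  have := ler_pM (sqr_ge0 _) (sqr_ge0 _) XAP YBQ.
  have := sqr_ge0 (A * Q - B * P); move: (x `^ r) (y `^ r) => x' y'; lra.
have -> : (x + y) `^ (2 * r) = 2 `^ (2 * r) * (((x + y) / 2) `^ r) ^+ 2.
  rewrite -sqr_pow ?divr_ge0 ?addr_ge0// -(powR_mulrn 2) ?divr_ge0 ?addr_ge0//.
  by rewrite -powRrM -powRM ?divr_ge0 ?addr_ge0// (mulrC 2 ((x + y) / 2)) divfK.
have mid := powR_midpoint r1 x0 y0.
have mid2 : (((x + y) / 2) `^ r) ^+ 2 <= ((x `^ r + y `^ r) / 2) ^+ 2.
  by rewrite ler_pXn2r ?nnegrE ?divr_ge0 ?addr_ge0 ?powR_ge0.
have pow2 (n : nat) : 2 `^ (2 * r - n%:R) = 2 `^ (2 * r) / 2 ^+ n :> R.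
  by rewrite powRB ?powR_mulrn// pnatr_eq0 implybT.
rewrite (pow2 3%N) (pow2 4%N) -!mulrA -mulrDr ler_pM2l ?powR_gt0//.
apply: le_trans mid2 _.
have := sqr_ge0 (A - P); have := sqr_ge0 (B - Q).
have := sqr_ge0 (A - Q); have := sqr_ge0 (B - P).
move: XAP YBQ XYle; move: (x `^ r) (y `^ r) => x' y'; lra.
Qed.

Theorem theorem3p10 (R : realType) (X : Type) (X_nonempty : inhabited X)
    (H : rkhs R X) (M N : H -> H) (r : R)
    (M_bounded : bounded_op M) (N_bounded : bounded_op N)
    (M_closed_range : closed (range M)) (N_closed_range : closed (range N))
    (r_ge1 : 1 <= r) :
  ber (M + N) `^ (2 * r) <=
    2 `^ (2 * r - 3) *
      (ber (op_pow (op_abs M) (2 * r) +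
            'i%C *: op_pow (N \o moore_penrose N) r) ^+ 2 +
       ber (op_pow (op_abs N) (2 * r) +
            'i%C *: op_pow (M \o moore_penrose M) r) ^+ 2) +
    2 `^ (2 * r - 4) *
      ber (op_pow (op_abs M) (2 * r) + op_pow (N \o moore_penrose N) r +
           'i%C *: (op_pow (op_abs N) (2 * r) +
                    op_pow (M \o moore_penrose M) r)) ^+ 2.
Proof.
have r2 : 1 <= 2 * r by lra.
have [bPM PMM PM2 sPM] := moore_penrose_projection M_bounded M_closed_range.
have [bPN PNN PN2 sPN] := moore_penrose_projection N_bounded N_closed_range.
set PM := M \o moore_penrose M in bPM PMM PM2 sPM *.
set PN := N \o moore_penrose N in bPN PNN PN2 sPN *.
have rPM u v : rinner (PM u) v = rinner u (PM v) by rewrite /rinner sPM.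
have rPN u v : rinner (PN u) v = rinner u (PN v) by rewrite /rinner sPN.
have pPM := op_pow_positive (projection_positive bPM PM2 rPM) r_ge1.
have pPN := op_pow_positive (projection_positive bPN PN2 rPN) r_ge1.
have pM := op_pow_positive (op_abs_positive M_bounded) r2.
have pN := op_pow_positive (op_abs_positive N_bounded) r2.
apply: sup_powR_le => [||_ [x kx <-]].
- lra.
- by rewrite addr_ge0// mulr_ge0 ?powR_ge0 ?addr_ge0 ?sqr_ge0.
split; first exact: Re_norm_ge0.
have u1 := rnorm_nkernel kx.
have f1 := ber_sqr_ge pM pPN kx; have f2 := ber_sqr_ge pN pPM kx.
have f3 := ber_sqr_ge (positive_opD pM pPN) (positive_opD pN pPM) kx.
move: f1 f2 f3 u1; rewrite /=; set u := nkernel H x => f1 f2 f3 u1.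
have Mu : complex.Re `|'[M u, u]| <= rnorm (M u) * rnorm (PM u).
  by have := norm_inner_le (M u) (PM u); rewrite -sPM PMM.
have Nu : complex.Re `|'[N u, u]| <= rnorm (N u) * rnorm (PN u).
  by have := norm_inner_le (N u) (PN u); rewrite -sPN PNN.
have MNu : complex.Re `|'[(M + N) u, u]| <=
    rnorm (M u) * rnorm (PM u) + rnorm (N u) * rnorm (PN u).
  rewrite (le_trans _ (lerD Mu Nu))// fctE linearDl.
  by have := ler_normD '[M u, u] '[N u, u]; rewrite lecE ReD => /andP[].
have MN0 := Re_norm_ge0 '[(M + N) u, u].
apply: (@le_trans _ _
  ((rnorm (M u) * rnorm (PM u) + rnorm (N u) * rnorm (PN u)) `^ (2 * r))).
  by apply: ge0_ler_powR; rewrite ?nnegrE ?addr_ge0 ?mulr_ge0 ?rnorm_ge0//; lra.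
apply: le_trans (scalar_bound r_ge1 (rnorm_ge0 _) (rnorm_ge0 _) (rnorm_ge0 _)
  (rnorm_ge0 _) (op_pow_abs_ge M_bounded r_ge1 u1)
  (op_pow_projection_ge bPM PM2 rPM r_ge1 u1) (op_pow_abs_ge N_bounded r_ge1 u1)
  (op_pow_projection_ge bPN PN2 rPN r_ge1 u1)) _.
rewrite lerD// ler_wpM2l ?powR_ge0//; first exact: lerD.
by move: f3; rewrite !fctE !rinnerDl.
Qed.
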